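(* Let $2\le r\le n\le 9$ and let $\mathcal{M}$ be a uniform oriented matroid of rank $r$ on $n$ elements. Then $\operatorname{diam}(G^*(\mathcal{M}))=n-r+2$. Moreover, if $X,Y$ are cocircuits of $\mathcal{M}$ with $X\neq -Y$, then $d_{\mathcal{M}}(X,Y)\le n-r+1$.
   Context: Sign vectors: for a finite set $E$ and $X\in\{+,-,0\}^E$, write $X^+=\{e:X_e=+\}$, $X^-=\{e:X_e=-\}$, $X^0=\{e:X_e=0\}$, $\operatorname{supp}(X)=X^+\cup X^-$, and $-X$ for the componentwise negation. For sign vectors $X,Y$, the separating set is $S(X,Y)=(X^+\cap Y^-)\cup(X^-\cap Y^+)$, and the composition $X\circ Y$ is given by $(X\circ Y)_e=X_e$ if $X_e\neq 0$ and $(X\circ Y)_e=Y_e$ otherwise. An oriented matroid $\mathcal{M}=(E,\mathcal{C}^* )$ is a finite set $E$ together with a set $\mathcal{C}^*\subseteq\{+,-,0\}^E$ of (signed) cocircuits satisfying: (CC0) $\mathbf{0}\notin\mathcal{C}^*$; (CC1) $X\in\mathcal{C}^*\Rightarrow -X\in\mathcal{C}^*$; (CC2) if $X,Y\in\mathcal{C}^*$ and $\operatorname{supp}(X)\subseteq\operatorname{supp}(Y)$ then $X=\pm Y$; (CC3) if $X,Y\in\mathcal{C}^*$, $X\neq -Y$ and $e\in S(X,Y)$, then there is $Z\in\mathcal{C}^*$ with $Z^+\subseteq (X^+\cup Y^+)\setminus\{e\}$ and $Z^-\subseteq (X^-\cup Y^-)\setminus\{e\}$. The covectors of $\mathcal{M}$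 are $\mathbf{0}$ together with all compositions $X^1\circ\cdots\circ X^k$ ($k\ge 1$) of cocircuits, partially ordered componentwise by $0<+$ and $0<-$ ($+,-$ incomparable). The rank $r$ of $\mathcal{M}$ is the largest $k$ such that there is a chain $\mathbf{0}=V_0<V_1<\cdots<V_k$ of covectors. $\mathcal{M}$ is uniform if $|X^0|=r-1$ for every cocircuit $X$. The cocircuit graph $G^*(\mathcal{M})$ has the cocircuits as vertices, with distinct cocircuits $X,Y$ adjacent iff $|X^0\cap Y^0|\ge r-2$ and $S(X,Y)=\emptyset$. $d_{\mathcal{M}}(X,Y)$ denotes graph distance in $G^*(\mathcal{M})$ and $\operatorname{diam}(G^*(\mathcal{M}))$ its maximum over pairs of cocircuits. *)

(* Defs.v *)
From mathcomp Require Import all_boot.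
Set Implicit Arguments. Unset Strict Implicit. Unset Printing Implicit Defensive.

Definition sgn := option bool.
Notation szero := (None : sgn).
Notation splus := (Some true : sgn).
Notation sminus := (Some false : sgn).

Definition svec (n : nat) := {ffun 'I_n -> sgn}.

Section SignVectors.
Variable n : nat.
Implicit Types X Y Z V W : svec n.

Definition sv0 : svec n := [ffun _ => szero].
Definition Xpos X : {set 'I_n} := [set e | X e == splus].
Definition Xneg X : {set 'I_n} := [set e | X e == sminus].
Definition Xzero X : {set 'I_n} := [set e | X e == szero].
Definition supp X : {set 'I_n} := Xpos X :|: Xneg X.
Definition sneg X : svec n := [ffun e => omap negb (X e)].
Definition sep X Y : {set 'I_n} := (Xpos X :&: Xneg Y) :|: (Xneg X :&: Xpos Y).
Definition scomp X Y : svec n :=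
  [ffun e => if X e == szero then Y e else X e].

(* Oriented matroid given by its set of signed cocircuits (axioms CC0-CC3). *)
Definition is_OM (C : {set svec n}) : Prop :=
  [/\ sv0 \notin C,
      (forall X, X \in C -> sneg X \in C),
      (forall X Y, X \in C -> Y \in C -> supp X \subset supp Y ->
          X = Y \/ X = sneg Y)
    & (forall X Y e, X \in C -> Y \in C -> X <> sneg Y -> e \in sep X Y ->
          exists2 Z, Z \in C &
            (Xpos Z \subset (Xpos X :|: Xpos Y) :\ e) /\
            (Xneg Z \subset (Xneg X :|: Xneg Y) :\ e))].

Definition covector (C : {set svec n}) V : Prop :=
  V = sv0 \/
  exists s : seq (svec n), [/\ s != [::], all (fun X => X \in C) s &
                              V = foldr scomp sv0 s].

Definition sle V W : bool := [forall e, (V e == szero) || (V e == W e)].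
Definition slt V W : bool := (V != W) && sle V W.

Definition has_chain (C : {set svec n}) (k : nat) : Prop :=
  exists s : seq (svec n),
    [/\ size s = k, (forall V, V \in s -> covector C V) & sorted slt (sv0 :: s)].

Definition OM_rank (C : {set svec n}) (r : nat) : Prop :=
  has_chain C r /\ forall k, has_chain C k -> k <= r.

Definition uniform (C : {set svec n}) (r : nat) : Prop :=
  forall X, X \in C -> #|Xzero X| = r - 1.

Definition cadj (C : {set svec n}) (r : nat) : rel (svec n) :=
  fun X Y => [&& X \in C, Y \in C, X != Y,
                 r - 2 <= #|Xzero X :&: Xzero Y| & sep X Y == set0].

Definition dist_le (C : {set svec n}) r X Y (k : nat) : Prop :=
  exists p : seq (svec n), [/\ path (cadj C r) X p, last X p = Y & size p <= k].

Definition is_dist (C : {set svec n}) r X Y (d : nat) : Prop :=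
  dist_le C r X Y d /\ forall k, k < d -> ~ dist_le C r X Y k.

Definition diam_is (C : {set svec n}) r (D : nat) : Prop :=
  (forall X Y, X \in C -> Y \in C -> exists2 d, is_dist C r X Y d & d <= D) /\
  (exists X Y, [/\ X \in C, Y \in C & is_dist C r X Y D]).

End SignVectors.

(* Main.v *)
(* A coline (all cocircuits vanishing on a fixed set of r - 2 elements) is a cycle in the
   cocircuit graph, and cocircuit elimination along it shows that two non-antipodal
   cocircuits X, Y of a coline are at distance at most |sep X Y| + 1.  Passing through a
   third point of the coline gives d(X, -X) <= n - r + 2, and counting the elements that
   have to vanish on the way gives the reverse inequality.

   For X <> -Y, put F = X^0 /\ Y^0, m = |X^0 \ F| and let k be the number of elements on
   which both X and Y are nonzero, so that n - r + 1 = m + k.  The case m <= 1 is that of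
   a coline.  Otherwise 2m + k <= 9, and we look for a sequence of zero sets from X^0 to
   Y^0, all containing F and each obtained from the previous one by one exchange, whose
   steps, each of cost 1 + |sep|, cost at most m + k together.  The signs of all cocircuits
   vanishing on F are encoded by a chirotope on the 2m + k elements outside F.  For each of
   the finitely many triples (m, k, |sep X Y|) a decision tree on the values of the chirotope
   settles the question: at each leaf, the signs decided so far either violate a three-term
   Grassmann-Pluecker relation or exhibit a cheap sequence.  Reorientation and relabelling
   keep the trees small. *)
From Corelib Require Import BinNums PosDef.
Require Import Defs.
From mathcomp Require Import all_boot zify.
Set Implicit Arguments. Unset Strict Implicit. Unset Printing Implicit Defensive.

(** * Sign vectors and distances along colines *)

Section SignVectorLemmas.
Variable n : nat.
Implicit Types X Y Z V W : svec n.

Lemma in_Xzero X e : (e \in Xzero X) = (X e == None).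
Proof. by rewrite inE. Qed.

Lemma in_supp X e : (e \in supp X) = (X e != None).
Proof. by rewrite !inE; case: (X e) => [[]|]. Qed.

Lemma suppE X : supp X = ~: Xzero X.
Proof. by apply/setP => e; rewrite in_supp in_setC in_Xzero. Qed.

Lemma snegE X e : sneg X e = omap negb (X e).
Proof. by rewrite ffunE. Qed.

Lemma snegK X : sneg (sneg X) = X.
Proof. by apply/ffunP => e; rewrite !snegE; case: (X e) => [[]|]. Qed.

Lemma Xzero_sneg X : Xzero (sneg X) = Xzero X.
Proof. by apply/setP => e; rewrite !in_Xzero snegE; case: (X e). Qed.

Lemma in_sep X Y e : (e \in sep X Y) = (X e != None) && (Y e == omap negb (X e)).
Proof. by rewrite !inE; case: (X e) => [[]|]; case: (Y e) => [[]|]. Qed.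

End SignVectorLemmas.

Section Distance.
Variables (n r : nat) (C : {set svec n}).
Implicit Types X Y Z : svec n.

Lemma dist_le_refl X k : dist_le C r X X k.
Proof. by exists [::]. Qed.

Lemma dist_le_weaken X Y k l : k <= l -> dist_le C r X Y k -> dist_le C r X Y l.
Proof. by move=> kl [p [pp lp sp]]; exists p; split=> //; apply: leq_trans kl. Qed.

Lemma dist_le_trans X Y Z k l :
  dist_le C r X Y k -> dist_le C r Y Z l -> dist_le C r X Z (k + l).
Proof.
move=> [p [pp lp sp]] [q [pq lq sq]]; exists (p ++ q).
by rewrite cat_path last_cat lp pp size_cat leq_add.
Qed.

(** A least length exists because having a path of exactly [k] edges is decidable: such paths range
    over the finite type of [k]-tuples. *)
Lemma is_dist_exists X Y k : dist_le C r X Y k -> exists2 d, is_dist C r X Y d & d <= k.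
Proof.
pose P k := [exists p : k.-tuple (svec n), path (cadj C r) X p && (last X p == Y)].
have dP l : dist_le C r X Y l <-> exists2 j, P j & j <= l.
  split=> [[p [pp lp sp]]|[j /existsP [p /andP [pp /eqP lp]] jl]].
    by exists (size p) => //; apply/existsP; exists (in_tuple p); rewrite pp lp /=.
  by exists p; rewrite pp lp size_tuple.
move=> /dP [j Pj jk]; have exP : exists j, P j by exists j.
case: (ex_minnP exP) => d Pd dmin; exists d; last exact: leq_trans (dmin _ Pj) jk.
split=> [|l ld /dP [i Pi il]]; first by apply/dP; exists d.
by have := leq_trans (dmin _ Pi) il; rewrite leqNgt ld.
Qed.

End Distance.

Section OrientedMatroid.
Variables (n r : nat) (C : {set svec n}).
Hypotheses (omC : is_OM C) (unifC : uniform C r).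
Implicit Types X Y Z P : svec n.

Lemma sneg_in X : X \in C -> sneg X \in C.
Proof. by case: omC => _ + _ _; apply. Qed.

Lemma cocircuit_unique X Y : X \in C -> Y \in C -> Xzero X = Xzero Y ->
  X = Y \/ X = sneg Y.
Proof. by case: omC => _ _ + _ XC YC e; apply=> //; rewrite !suppE e. Qed.

Lemma cocircuit_elim X Y e : X \in C -> Y \in C -> X <> sneg Y -> e \in sep X Y ->
  exists2 Z, Z \in C & Z e = None /\
    forall f s, Z f = Some s -> X f = Some s \/ Y f = Some s.
Proof.
case: omC => _ _ _ CC3 XC YC XnY /(CC3 X Y e XC YC XnY) [Z ZC [Zp Zm]]; exists Z => //.
have ZeD f s : Z f = Some s -> f <> e /\ (X f = Some s \/ Y f = Some s).
  case: s => Zf; [move: Zp | move: Zm] => /subsetP /(_ f); rewrite !inE Zf => /(_ isT).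
    by case/andP => /eqP fe /orP [] /eqP; auto.
  by case/andP => /eqP fe /orP [] /eqP; auto.
split=> [|f s /ZeD []//]; case Ze: (Z e) => [s|//]; by case: (ZeD _ _ Ze).
Qed.

(** Induction on the separation. Eliminating [e] gives [Z] on the same coline, and [sep X Z] and
    [sep Z Y] are disjoint subsets of [sep X Y] missing [e]; their sizes add up to less than
    [#|sep X Y|], which pays for the extra 1 of the second leg. *)
Lemma coline_dist X Y : X \in C -> Y \in C -> X <> sneg Y ->
  r - 2 <= #|Xzero X :&: Xzero Y| -> dist_le C r X Y (#|sep X Y| + 1).
Proof.
have [k] := ubnP #|sep X Y|; elim: k X Y => // k IH X Y sk XC YC XnY cXY.
have [->|/eqP XY] := eqVneq X Y; first exact: dist_le_refl.
have [s0|[e eXY]] := set_0Vmem (sep X Y).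
  exists [:: Y]; split=> //=; last by rewrite addn1.
  by rewrite /cadj XC YC cXY s0 eqxx !andbT; apply/eqP.
have [Z ZC [Ze ZXY]] := cocircuit_elim XC YC XnY eXY.
have [Xe Ye] : X e != None /\ Y e != None.
  by move: eXY; rewrite in_sep => /andP [Xe /eqP ->]; case: (X e) Xe.
have zZ f : X f = None -> Y f = None -> Z f = None.
  by move=> Xf Yf; case Zf: (Z f) => [s|//]; case: (ZXY _ _ Zf) => //; rewrite ?Xf ?Yf.
have sXZ : sep X Z \subset sep X Y :\ e.
  apply/subsetP => f; rewrite in_setD1 !in_sep; case Xf: (X f) => [s|//] /= /eqP Zf.
  have [fe|_] := eqVneq f e; first by rewrite -fe Zf in Ze.
  by case: (ZXY _ _ Zf) => [|->]; rewrite ?Xf ?eqxx //; case: (s).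
have sZY : sep Z Y \subset sep X Y :\ e.
  apply/subsetP => f; rewrite in_setD1 !in_sep; case Zf: (Z f) => [s|//] /= /eqP Yf.
  have [fe|_] := eqVneq f e; first by rewrite fe Ze in Zf.
  by case: (ZXY _ _ Zf) => [->|]; rewrite Yf /= ?eqxx // => -[]; case: (s).
have dsj : sep X Z :&: sep Z Y = set0.
  apply/setP => f; rewrite in_setI !in_sep in_set0.
  case Zf: (Z f) => [s|] /=; last by rewrite andbF.
  by case: (ZXY _ _ Zf) => ->; case: (s); rewrite /= ?andbF.
have cs : #|sep X Z| + #|sep Z Y| < #|sep X Y|.
  rewrite -cardsUI dsj cards0 addn0 (cardsD1 e (sep X Y)) eXY add1n ltnS.
  by apply: subset_leq_card; rewrite subUset sXZ sZY.
apply: (@dist_le_weaken _ _ _ _ _ ((#|sep X Z| + 1) + (#|sep Z Y| + 1))).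
  by lia.
apply: dist_le_trans.
- apply: IH => //; first by lia.
  + by move=> XZ; move: Xe; rewrite XZ snegE Ze.
  + apply: leq_trans cXY (subset_leq_card _); apply/subsetP => f.
    by rewrite !in_setI !in_Xzero => /andP [/eqP Xf /eqP Yf]; rewrite Xf zZ.
- apply: IH => //; first by lia.
  + by move=> ZY; move: Ye; rewrite -[Y]snegK -ZY snegE Ze.
  + apply: leq_trans cXY (subset_leq_card _); apply/subsetP => f.
    by rewrite !in_setI !in_Xzero => /andP [/eqP Xf /eqP Yf]; rewrite Yf zZ.
Qed.

End OrientedMatroid.

(** * Zero sets of cocircuits, antipodal cocircuits *)

Section ZeroSets.
Variables (n r : nat) (C : {set svec n}).
Hypotheses (omC : is_OM C) (unifC : uniform C r) (r_ge2 : 2 <= r).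
Implicit Types (X Y Z V W : svec n) (A B D : {set 'I_n}).

Definition hyperplane A := [exists X in C, Xzero X == A].

Lemma hyperplaneP A : reflect (exists2 X, X \in C & Xzero X = A) (hyperplane A).
Proof.
apply: (iffP existsP) => [[X /andP [XC /eqP <-]]|[X XC XA]]; first by exists X.
by exists X; rewrite XC XA eqxx.
Qed.

Lemma card_hyperplane A : hyperplane A -> #|A| = r - 1.
Proof. by case/hyperplaneP => X XC <-; apply: unifC. Qed.

(** Replacing [Y] by its negative, if necessary, puts [e] into the separation, so that (CC3) applies
    and becomes hyperplane elimination for the underlying matroid. *)
Lemma hyperplane_elim A B e : hyperplane A -> hyperplane B -> A != B ->
  e \notin A -> e \notin B -> exists2 D, hyperplane D & e |: A :&: B \subset D.
Proof.
case/hyperplaneP => X XC <- /hyperplaneP [Y YC <-] XY; rewrite !in_Xzero => Xe Ye.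
have [Y' [Y'C zY' eXY']] : exists Y', [/\ Y' \in C, Xzero Y' = Xzero Y & e \in sep X Y'].
  have [eXY|eXY] := boolP (e \in sep X Y); first by exists Y.
  exists (sneg Y); split; [exact: sneg_in | exact: Xzero_sneg|].
  by move: eXY Xe Ye; rewrite !in_sep snegE; case: (X e) => [[]|]; case: (Y e) => [[]|].
have XY' : X <> sneg Y' by move=> E; rewrite E Xzero_sneg zY' eqxx in XY.
have [Z ZC [Ze ZXY]] := cocircuit_elim omC XC Y'C XY' eXY'.
exists (Xzero Z); first by apply/hyperplaneP; exists Z.
apply/subsetP => f; rewrite in_setU1 -zY' in_setI !in_Xzero.
case/orP => [/eqP ->|/andP [/eqP Xf /eqP Yf]]; first by rewrite Ze.
by case Zf: (Z f) => [s|//]; case: (ZXY _ _ Zf); rewrite ?Xf ?Yf.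
Qed.

(** The zero set of a composition is the intersection of the zero sets of its factors. *)
Lemma covector_zero V : covector C V -> V <> sv0 n ->
  (exists2 A, hyperplane A & Xzero V \subset A) /\
  (forall y, y \notin Xzero V -> exists2 A, hyperplane A & (Xzero V \subset A) && (y \notin A)).
Proof.
case=> // -[s [s0 sC ->]] _.
have sub X : X \in s -> Xzero (foldr (@scomp n) (sv0 n) s) \subset Xzero X.
  elim: s {s0 sC} => //= Y s IH; rewrite inE => /predU1P [->|/IH sX].
    by apply/subsetP => e; rewrite !in_Xzero ffunE; case: (Y e).
  apply: subset_trans sX; apply/subsetP => e; rewrite !in_Xzero ffunE.
  by case: (Y e).
have hyp X : X \in s -> hyperplane (Xzero X).
  by move=> Xs; apply/hyperplaneP; exists X => //; exact: (allP sC).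
split=> [|y].
  by case: s s0 sub hyp {sC} => // X s _ sub hyp; exists (Xzero X); [apply: hyp | apply: sub];
    rewrite mem_head.
rewrite in_Xzero => yV.
suff [X Xs Xy] : exists2 X, X \in s & X y != None.
  by exists (Xzero X); rewrite ?hyp // sub //= in_Xzero.
elim: s yV {s0 sC sub hyp} => [|X s IH] /=; first by rewrite ffunE.
rewrite ffunE; have [_ yV|Xy _] := eqVneq (X y) None; last by exists X; rewrite ?mem_head.
by have [Y Ys Yy] := IH yV; exists Y; rewrite // inE Ys orbT.
Qed.

(** The property that descends along a maximal chain of covectors; at [set0] it concerns all sets of
    r - 1 elements. *)
Definition good_flat D := forall A, D \subset A -> #|A| = r - 1 -> hyperplane A.

(* With Xzero V = y + Xzero W, exchanges lead from a hyperplane U avoiding y to A: eliminating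
   between U and y + (U - u), which is a hyperplane above Xzero V, gives w + (U - u). *)
Lemma good_flat_step V W : covector C W -> W <> sv0 n ->
  Xzero W \subset Xzero V -> #|Xzero V| = #|Xzero W|.+1 ->
  good_flat (Xzero V) -> good_flat (Xzero W).
Proof.
move=> covW W0 WV cV gV.
have [y yV yW] : exists2 y, y \in Xzero V & y \notin Xzero W.
  apply/subsetPn; apply/negP => VW; have := subset_leq_card VW; lia.
have eV : Xzero V = y |: Xzero W.
  apply/eqP; rewrite eq_sym eqEcard subUset sub1set yV WV cardsU1 yW; lia.
have [_ /(_ y yW) [U0 hU0 /andP [WU0 yU0]]] := covector_zero covW W0.
move=> A WA cA; have [yA|yA] := boolP (y \in A).
  by apply: gV => //; rewrite eV subUset sub1set yA.
have [k] := ubnP #|A :\: U0|; elim: k U0 hU0 WU0 yU0 => // k IH U hU WU yU kU.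
have cU := card_hyperplane hU.
have [/eqP|[w /setDP [wA wU]]] := set_0Vmem (A :\: U).
  by rewrite setD_eq0 => AU; have /eqP -> : A == U by rewrite eqEcard AU cU cA /=.
have [u uU uA] : exists2 u, u \in U & u \notin A.
  apply/subsetPn; apply/negP => UA; have /eqP E : U == A by rewrite eqEcard UA cU cA /=.
  by rewrite E wA in wU.
have uW : u \notin Xzero W by exact: contra (subsetP WA u) uA.
have yu : y != u by apply: contraNneq yU => ->.
have hU1 : hyperplane (y |: U :\ u).
  apply: gV; last by rewrite cardsU1 !inE (negPf yU) andbF /= -cU (cardsD1 u U) uU.
  by rewrite eV setUS // subsetD1 WU.
have wy : w != y by apply: contraNneq yA => <-.
have [||T hT] := hyperplane_elim hU hU1 _ wU.
- by apply: contraNneq yU => ->; rewrite setU11.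
- by rewrite !inE (negPf wy) (negPf wU) andbF.
have -> : U :&: (y |: U :\ u) = U :\ u.
  apply/setP => e; rewrite !inE; case: eqVneq => [->|_] /=; first by rewrite (negPf yU) andbF.
  by case: (e \in U); rewrite ?andbT ?andbF.
move=> sT; have eT : T = w |: U :\ u.
  apply/eqP; rewrite eq_sym eqEcard sT (card_hyperplane hT) -cU cardsU1 !inE (negPf wU) andbF.
  by rewrite (cardsD1 u U) uU /=.
have sWU : Xzero W \subset U :\ u by rewrite subsetD1 WU.
apply: (IH T) => //.
- by rewrite eT; apply: subset_trans sWU (subsetUr _ _).
- by rewrite eT !inE eq_sym (negPf wy) (negPf yU) andbF.
- rewrite -ltnS; apply: leq_trans kU; rewrite ltnS; apply: proper_card.
  rewrite eT; apply/properP; split; last by exists w; rewrite !inE ?eqxx ?wA ?wU.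
  apply/subsetP => e; rewrite !inE negb_or negb_and negbK => /andP [/andP [ew eu] eA].
  by rewrite eA andbT; case/orP: eu => [/eqP E|//]; rewrite -E eA in uA.
Qed.

Lemma slt_zero V W : slt V W -> Xzero W \proper Xzero V.
Proof.
case/andP => VW /forallP sVW; apply/properP; split.
  apply/subsetP => e; rewrite !in_Xzero => /eqP We; move: (sVW e).
  by rewrite We orbb.
apply/subsetPn; apply: contra VW => /subsetP sub; apply/eqP/ffunP => e.
case/orP: (sVW e) => /eqP // Ve; move: (sub e); rewrite !in_Xzero Ve eqxx => /(_ isT) /eqP ->.
by [].
Qed.

Lemma path_slt_card V s : path (@slt n) V s -> size s <= #|Xzero V|.
Proof.
elim: s V => //= W s IH V /andP [/slt_zero/proper_card c1 /IH c2].
exact: leq_ltn_trans c2 c1.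
Qed.

(** Zero sets shrink strictly along a chain, so a chain with at least [#|Xzero V|] further steps
    loses exactly one element at each, as [good_flat_step] requires. *)
Lemma good_flat_path V s : path (@slt n) V s -> (forall W, W \in V :: s -> covector C W) ->
  #|Xzero V| <= size s -> good_flat (Xzero V) -> good_flat set0.
Proof.
elim: s V => [|W s IH] V /=.
  by move=> _ _; rewrite leqn0 cards_eq0 => /eqP ->.
case/andP => VW ps cov cV gV.
have pVW := slt_zero VW; have c1 := path_slt_card ps.
have c2 : #|Xzero W| < #|Xzero V| by apply: proper_card.
apply: (IH W) => //; first by move=> U Us; apply: cov; rewrite inE Us orbT.
  by rewrite -ltnS; apply: leq_trans c2 cV.
apply: good_flat_step gV; last 1 first.
- by apply/eqP; rewrite eqn_leq c2 andbT; apply: leq_trans cV _; rewrite ltnS.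
- by apply: cov; rewrite !inE eqxx orbT.
- move=> W0; case/properP: pVW => _ [e _]; rewrite in_Xzero W0.
  by rewrite ffunE.
- exact: proper_sub.
Qed.

(** The first nonzero covector of a chain of length r vanishes on at least r - 1 elements, since r -
    1 strict steps follow, and its zero set lies in a hyperplane. The two are therefore equal, and
    [good_flat_path] descends from there to [set0]. *)
Lemma hyperplane_all A : has_chain C r -> #|A| = r - 1 -> hyperplane A.
Proof.
case=> -[|V s] [ss cov] /=; first by move: r_ge2; rewrite -ss.
case/andP => V0 ps cA.
have Vn0 : V <> sv0 n by move=> E; move: V0; rewrite /slt E eqxx.
have [[B hB VB] _] := covector_zero (cov V (mem_head _ _)) Vn0.
have cs : size s = r - 1 by rewrite -ss subn1.
have cB := card_hyperplane hB; have c1 := path_slt_card ps.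
have c2 : #|Xzero V| <= r - 1 by rewrite -cB; apply: subset_leq_card.
apply: (good_flat_path ps cov) (sub0set _) cA; first by rewrite cs.
have /eqP eVB : Xzero V == B by rewrite eqEcard VB cB -cs.
move=> A' VA' cA'; have /eqP <- // : B == A'.
by rewrite eqEcard -eVB VA' eVB cB cA' /=.
Qed.

(** Adjacent zero sets have r - 1 elements and share at least r - 2, so each edge contributes at
    most one new element. *)
Lemma path_crossing X p : path (cadj C r) X p ->
  #|(\bigcup_(Z <- p) Xzero Z) :\: Xzero X| <= size p.
Proof.
elim: p X => [|Y p IH] X /=; first by rewrite big_nil set0D cards0.
case/andP => /and5P [XC YC XY cXY _] /IH {}IH; rewrite big_cons.
set U := \bigcup_(Z <- p) Xzero Z in IH *.
have sub : (Xzero Y :|: U) :\: Xzero X \subset (U :\: Xzero Y) :|: (Xzero Y :\: Xzero X).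
  by apply/subsetP => e; rewrite !(in_setU, in_setD); do 3 case: (_ \in _).
apply: leq_trans (subset_leq_card sub) _; apply: leq_trans (leq_card_setU _ _) _.
have := cardsID (Xzero X) (Xzero Y); rewrite setIC (unifC YC); move: cXY IH.
move: #|_| #|_| #|_| => a b c; lia.
Qed.

(** Signs never conflict along an edge, so each element of the support must vanish somewhere on the
    way to -X, and this before the last vertex, whose support is that of [X]. *)
Lemma antipodal_dist_ge X p : X \in C -> path (cadj C r) X p -> last X p = sneg X ->
  #|supp X| < size p.
Proof.
move=> XC; case/lastP: p => [_ /= E|p Y].
  have /eqP Xs : supp X == set0.
    apply/eqP/setP => e; rewrite in_supp in_set0; move/ffunP: E => /(_ e).
    by rewrite snegE; case: (X e) => [[]|].
  have X0 : X = sv0 n.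
    apply/ffunP => e; move/setP/(_ e): Xs; rewrite in_supp in_set0 ffunE.
    by case: (X e).
  by case: omC; rewrite -X0 XC.
rewrite rcons_path last_rcons size_rcons => /andP [pp adj] E; subst Y.
rewrite ltnS; apply: leq_trans (path_crossing pp); apply: subset_leq_card.
apply/subsetP => e; rewrite in_supp in_setD in_Xzero => Xe; rewrite Xe /=.
apply/negPn/negP => eU.
have const : last X p e = X e.
  move: eU pp {adj}; elim/last_ind: p => // p Z IH; rewrite big_rcons /= !inE negb_or.
  case/andP => eU Ze; rewrite rcons_path last_rcons => /andP [pp /and5P [_ _ _ _ /eqP s0]].
  have {}IH := IH eU pp; move/setP/(_ e): s0; rewrite in_sep IH Xe /= in_set0.
  by move: Xe Ze; case: (X e) => [[]|]; case: (Z e) => [[]|].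
case/and5P: adj => _ _ _ _ /eqP/setP/(_ e); rewrite in_sep const Xe snegE eqxx.
by rewrite in_set0.
Qed.

Lemma card_supp X : X \in C -> #|supp X| = n - (r - 1).
Proof. by move=> XC; rewrite suppE cardsCs setCK (unifC XC) card_ord. Qed.

(** Exchanging a zero [a] of [X] for [b] gives [Y]. In the support of [X], the element [b] separates
    neither of the pairs X, Y and Y, -X, and any other element at most one of them; so the two legs
    cost at most (n - r) + 2. *)
Lemma antipodal_dist_le X : has_chain C r -> r <= n -> X \in C -> dist_le C r X (sneg X) (n - r + 2).
Proof.
move=> ch rn XC; have cX := unifC XC.
have [a aX] : exists a, a \in Xzero X by apply/card_gt0P; lia.
have [b bX] : exists b, b \in supp X by apply/card_gt0P; rewrite card_supp //; lia.
have bnX : b \notin Xzero X by move: bX; rewrite suppE in_setC.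
have := @hyperplane_all (b |: Xzero X :\ a) ch.
rewrite cardsU1 !inE -in_Xzero (negPf bnX) andbF /=.
have c1 : #|Xzero X :\ a| = r - 2 by have := cardsD1 a (Xzero X); rewrite aX; lia.
rewrite c1 => /(_ ltac:(lia)) /hyperplaneP [Y YC zY].
have XYn : Xzero X != Xzero Y by apply: contraNneq bnX => ->; rewrite zY setU11.
have cI : r - 2 <= #|Xzero X :&: Xzero Y|.
  rewrite -c1; apply: subset_leq_card; rewrite zY subsetI subsetDl /=.
  exact: subsetUr.
have XnY : X <> sneg Y by move=> E; rewrite E Xzero_sneg eqxx in XYn.
have YnX : Y <> sneg (sneg X) by rewrite snegK => E; rewrite E eqxx in XYn.
apply: dist_le_weaken (dist_le_trans (coline_dist omC XC YC XnY cI) (coline_dist omC YC (sneg_in omC XC) YnX _)).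
  suff : #|sep X Y| + #|sep Y (sneg X)| <= n - r by lia.
  rewrite -cardsUI.
  have -> : sep X Y :&: sep Y (sneg X) = set0.
    apply/setP => e; rewrite in_setI !in_sep snegE in_set0.
    by case: (X e) => [[]|]; case: (Y e) => [[]|].
  rewrite cards0 addn0.
  have -> : n - r = #|supp X :\ b| by have := cardsD1 b (supp X); rewrite bX card_supp //; lia.
  apply: subset_leq_card; apply/subsetP => e; rewrite in_setU in_setD1 in_supp !in_sep snegE.
  have [->|] := eqVneq e b; last by case: (X e) => [[]|]; case: (Y e) => [[]|].
  have /eqP -> : Y b == None by rewrite -in_Xzero zY setU11.
  by case: (X b).
by rewrite Xzero_sneg setIC.
Qed.

End ZeroSets.

(** * Signs along a coline *)

Section Colines.
Variables (n r : nat) (C : {set svec n}).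
Hypotheses (omC : is_OM C) (unifC : uniform C r).
Implicit Types (X Y Z P : svec n) (S : {set 'I_n}).

(** Meaningful only off the zero set, where negation of [X] flips it. *)
Definition sval X e : bool := X e == splus.

Lemma sval_sneg X e : X e != None -> sval (sneg X) e = ~~ sval X e.
Proof. by rewrite /sval snegE; case: (X e) => [[]|]. Qed.

Lemma sval_inj X Y e : X e != None -> Y e != None -> (sval X e == sval Y e) = (X e == Y e).
Proof. by rewrite /sval; case: (X e) => [[]|]; case: (Y e) => [[]|]. Qed.

(** Eliminating [c] between [X] and [Y] yields a cocircuit vanishing on [c |: S], hence plus or
    minus [Z]. At [a], where [X] vanishes, its sign can only come from [Y], and conversely at
    [b]. *)
Lemma coline_point X Y Z S a b c :
  X \in C -> Y \in C -> Z \in C ->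
  Xzero X = a |: S -> Xzero Y = b |: S -> Xzero Z = c |: S ->
  a \notin S -> b \notin S -> c \notin S -> a != b -> c != a -> c != b ->
  X c != Y c ->
  exists2 Z', Z' = Z \/ Z' = sneg Z &
    [/\ Z' a = Y a, Z' b = X b & forall d, d \notin S -> d != c -> X d = Y d -> Z' d = X d].
Proof.
move=> XC YC ZC zX zY zZ aS bS cS ab ca cb XYc.
have nz W x e : Xzero W = x |: S -> e \notin S -> e != x -> W e != None.
  by move=> zW eS ex; rewrite -in_Xzero zW in_setU1 negb_or ex.
have cXY : c \in sep X Y.
  have := nz X a c zX cS ca; have := nz Y b c zY cS cb; move: XYc; rewrite in_sep.
  by case: (X c) => [[]|]; case: (Y c) => [[]|].
have XnY : X <> sneg Y.
  move=> E; have : a \in Xzero X by rewrite zX setU11.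
  by rewrite E Xzero_sneg zY in_setU1 (negPf ab) (negPf aS).
have [Z' Z'C [Z'c Z'XY]] := cocircuit_elim omC XC YC XnY cXY.
have zZ' : Xzero Z' = Xzero Z.
  apply/eqP; rewrite eq_sym eqEcard !(unifC, Z'C, ZC) //= leqnn andbT zZ.
  apply/subsetP => e; rewrite in_setU1 in_Xzero => /predU1P [->|eS]; first by rewrite Z'c.
  have Xe : X e = None by apply/eqP; rewrite -in_Xzero zX in_setU1 eS orbT.
  have Ye : Y e = None by apply/eqP; rewrite -in_Xzero zY in_setU1 eS orbT.
  by case Ze: (Z' e) => [s|//]; case: (Z'XY _ _ Ze); rewrite ?Xe ?Ye.
exists Z'; first exact: (cocircuit_unique omC).
have nzZ' e : e \notin S -> e != c -> Z' e != None by apply: nz; rewrite zZ'.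
have X0 x W : Xzero W = x |: S -> W x = None.
  by move=> zW; apply/eqP; rewrite -in_Xzero zW setU11.
split.
- have := nzZ' a aS; rewrite eq_sym ca => /(_ isT); case Za: (Z' a) => [s|//] _.
  by case: (Z'XY _ _ Za) => //; rewrite (X0 _ _ zX).
- have := nzZ' b bS; rewrite eq_sym cb => /(_ isT); case Zb: (Z' b) => [s|//] _.
  by case: (Z'XY _ _ Zb) => //; rewrite (X0 _ _ zY).
- move=> d dS dc XYd; have := nzZ' d dS dc; case Zd: (Z' d) => [s|//] _.
  by case: (Z'XY _ _ Zd) => //; rewrite XYd.
Qed.

(** Each cocircuit enters through products of two of its signs, so it may be negated; once [X] and
    [Y] are opposite at [c], [coline_point] applies. The first part makes sign changes consistent on
    triangles of bases, the second is the source of the Grassmann-Pluecker relations. *)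
Lemma coline_signs X Y Z S a b c :
  X \in C -> Y \in C -> Z \in C ->
  Xzero X = a |: S -> Xzero Y = b |: S -> Xzero Z = c |: S ->
  a \notin S -> b \notin S -> c \notin S -> a != b -> c != a -> c != b ->
  sval X b (+) sval X c (+) (sval Y a (+) sval Y c) (+) (sval Z a (+) sval Z b) /\
  forall d, d \notin S -> d != a -> d != b -> d != c ->
    sval X c (+) sval X d (+) (sval Y c (+) sval Y d) ->
    sval X b (+) sval X d = sval Z b (+) sval Z d.
Proof.
move=> XC YC ZC zX zY zZ aS bS cS ab ca cb.
have nz W x e : Xzero W = x |: S -> e \notin S -> e != x -> W e != None.
  by move=> zW eS ex; rewrite -in_Xzero zW in_setU1 negb_or ex.
have [Ya Yc] : Y a != None /\ Y c != None by split; apply: nz zY _ _.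
have [Xb Xc] : X b != None /\ X c != None by split; apply: nz zX _ _ => //; rewrite eq_sym.
have [Za Zb] : Z a != None /\ Z b != None by split; apply: nz zZ _ _ => //; rewrite eq_sym.
wlog XYc : Y YC zY Ya Yc / X c != Y c.
  move=> wl; have [E|] := eqVneq (X c) (Y c); last exact: wl.
  have [|||||] := wl (sneg Y); rewrite ?Xzero_sneg ?sneg_in //.
  - by rewrite snegE; case: (Y a) Ya.
  - by rewrite snegE; case: (Y c) Yc.
  - by rewrite snegE E; case: (Y c) Yc => [[]|].
  rewrite !sval_sneg // => t1 t2; split; first by move: t1; do 6 case: (sval _ _).
  move=> d dS da db dc H; apply: t2 => //.
  have Yd : Y d != None by apply: nz zY _ _.
  by rewrite sval_sneg //; move: H; do 4 case: (sval _ _).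
have [Z' Z'Z [Z'a Z'b Z'd]] := coline_point XC YC ZC zX zY zZ aS bS cS ab ca cb XYc.
have Ysc : sval Y c = ~~ sval X c.
  by move: XYc; rewrite -(sval_inj Xc Yc); do 2 case: (sval _ _).
have sZ e f : Z e != None -> Z f != None -> sval Z e (+) sval Z f = sval Z' e (+) sval Z' f.
  by case: Z'Z => -> // Ze Zf; rewrite !sval_sneg //; do 2 case: (sval _ _).
split=> [|d dS da db dc].
  have -> : sval Z a (+) sval Z b = sval Y a (+) sval X b by rewrite sZ // /sval Z'a Z'b.
  by rewrite Ysc; do 3 case: (sval _ _).
have Zd : Z d != None by apply: nz zZ _ _.
have Xd : X d != None by apply: nz zX _ _.
have Yd : Y d != None by apply: nz zY _ _.
move=> H; have XYd : X d = Y d.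
  apply/eqP; rewrite -sval_inj //; move: H; rewrite Ysc.
  by case: (sval X c); case: (sval X d); case: (sval Y d).
by rewrite sZ // /sval Z'b (Z'd d).
Qed.

(* The points P of the coline, oriented by P a = v, are sorted by #|sep X P|: if P_b and X
   differ at b', eliminating b' between them gives P_b', which is nearer to X. *)
Lemma coline_order X S a (v : bool) (Q : {set 'I_n}) :
  has_chain C r -> 2 <= r -> X \in C -> Xzero X = a |: S -> a \notin S ->
  [disjoint Q & Xzero X] ->
  exists2 s, perm_eq s (enum Q) &
    pairwise (fun b b' => [forall P in C, (Xzero P == b |: S) ==>
                  ((P b' == X b') == (P a == Some v))]) s.
Proof.
move=> ch r2 XC zX aS dQ.
have cS : #|S| = r - 2 by have := unifC XC; rewrite zX cardsU1 aS; lia.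
have nQ b : b \in Q -> (b \notin S) * (b != a).
  by move=> bQ; have := disjointFr dQ bQ; rewrite zX in_setU1 => /norP [-> ->].
have exP b : b \in Q -> exists P, [&& P \in C, Xzero P == b |: S & P a == Some v].
  move=> bQ; have [bS ba] := nQ b bQ.
  have : hyperplane C (b |: S) by apply: (hyperplane_all omC unifC) => //; rewrite cardsU1 bS cS; lia.
  case/hyperplaneP => P PC zP.
  have : P a != None by rewrite -in_Xzero zP in_setU1 (negPf aS) eq_sym (negPf ba).
  have [Pa _|Pa Pa0] := eqVneq (P a) (Some v); first by exists P; rewrite PC zP Pa !eqxx.
  exists (sneg P); rewrite sneg_in // Xzero_sneg zP eqxx snegE /=.
  by move: Pa Pa0; case: (P a) => [[]|]; case: (v).
(* By [exP] the default [X] is never taken for [b] in [Q]. *)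
pose P b := odflt X [pick P | [&& P \in C, Xzero P == b |: S & P a == Some v]].
have PP b : b \in Q -> [/\ P b \in C, Xzero (P b) = b |: S & P b a = Some v].
  move=> bQ; rewrite /P; case: pickP => [P0 /and3P [? /eqP ? /eqP ?]//|E].
  by case: (exP b bQ) => P0; rewrite E.
pose pos b := #|sep X (P b)|.
exists (sort (relpre pos leq) (enum Q)); first by rewrite perm_sort.
set s := sort _ _.
have sQ : {subset s <= Q} by move=> b; rewrite mem_sort mem_enum.
have srt : sorted (relpre pos leq) s by apply: sort_sorted => b b'; apply: leq_total.
have uniq_s : uniq s by rewrite sort_uniq enum_uniq.
rewrite (sorted_pairwise (fun _ _ _ => @leq_trans _ _ _)) in srt.
have {srt uniq_s}: pairwise (fun b b' => (pos b <= pos b') && (b != b')) s.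
  elim: s srt uniq_s {sQ} => //= b s IH /andP [bs /IH {}IH] /andP [nb /IH ->]; rewrite andbT.
  apply/allP => b' b's; rewrite (allP bs) //=; apply: contraNneq nb => ->; exact: b's.
apply: (@sub_in_pairwise _ (mem Q)); last by apply/allP.
move=> b b' bQ b'Q /andP [le_pos bb'].
have [[bS ba] [b'S b'a]] := (nQ b bQ, nQ b' b'Q).
have [[PbC zPb Pba] [PbC' zPb' Pba']] := (PP b bQ, PP b' b'Q).
have nzX e : e \in Q -> X e != None by move=> eQ; rewrite -in_Xzero (disjointFr dQ eQ).
have Pbb' : P b b' != None by rewrite -in_Xzero zPb in_setU1 eq_sym (negPf bb') (negPf b'S).
have eqPX : P b b' = X b'.
  apply/eqP/negPn/negP => ne.
  have := coline_point XC PbC PbC' zX zPb zPb' aS bS b'S.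
  rewrite [a == b]eq_sym ba b'a eq_sym in ne *; rewrite eq_sym bb' ne => /(_ isT isT isT isT).
  case=> Z' Z'Pb' [Z'a Z'b Z'd].
  have eZ : Z' = P b'.
    case: Z'Pb' => // E; move: Z'a; rewrite E Pba snegE Pba' /=.
    by case: (v).
  have : pos b' < pos b; last by rewrite ltnNge le_pos.
  have b'sep : b' \in sep X (P b).
    by move: ne Pbb' (nzX b' b'Q); rewrite in_sep; case: (X b') => [[]|]; case: (P b b') => [[]|].
  rewrite /pos [X in _ < X](cardsD1 b') b'sep ltnS; apply: subset_leq_card.
  apply/subsetP => e; rewrite in_setD1 !in_sep => /andP [Xe /eqP Pe]; rewrite Xe /=.
  have eS : e \notin S by apply: contra Xe => eS; rewrite -in_Xzero zX in_setU1 eS orbT.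
  have [ee|eb'] := eqVneq e b'.
    have : P b' b' == None by rewrite -in_Xzero zPb' setU11.
    by rewrite -{2}ee Pe; case: (X e) Xe.
  have [E|ne'] := eqVneq (X e) (P b e).
    by have := Z'd e eS eb' E; rewrite eZ Pe; case: (X e) Xe => [[]|].
  (* The exceptional place is [e = b], where [P b] vanishes and the eliminated vector has the sign
     of [X]. *)
  have : P b e != None \/ e = b.
    have [->|eb] := eqVneq e b; first by right.
    by left; rewrite -in_Xzero zPb in_setU1 (negPf eb) (negPf eS).
  case=> [|ee]; first by move: ne' Xe; case: (X e) => [[]|]; case: (P b e) => [[]|].
  move: Pe; rewrite -eZ ee Z'b; move: Xe; rewrite ee; case: (X b) => [[]|] //.
(* The only other cocircuit with this zero set is the negative of [P b], and negation reverses both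
   comparisons. *)
apply/forallP => P0; apply/implyP => P0C; apply/implyP => /eqP zP0.
have := cocircuit_unique omC P0C PbC; rewrite zP0 zPb => /(_ erefl) [] ->.
  by rewrite eqPX Pba !eqxx.
have := nzX b' b'Q; rewrite !snegE -eqPX Pba; move: Pbb'.
by case: (P b b') => [[]|] // _ _; case: (v).
Qed.

End Colines.

(** * Existence of a chirotope *)

Ltac cases1 f := repeat match goal with |- context [f ?x] => case: (f x) end.
Ltac cases2 f := repeat match goal with |- context [f ?x ?y] => case: (f x y) end.

Section Chirotope.
Variables (N m : nat).
Implicit Types (S Z T : {set 'I_N}) (a b c e t z w : 'I_N).

(* The sign, up to a factor depending on Z only, of sorting e into Z; signs are written
   additively throughout, a change of sign being [true]. *)
Definition spar Z e : bool := odd #|[set i in Z | i < e]|.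

Lemma spar_add S a e : a \notin S -> spar (a |: S) e = (a < e) (+) spar S e.
Proof.
move=> aS; rewrite /spar; case: ltnP => ae /=.
  suff -> : [set i in a |: S | i < e] = a |: [set i in S | i < e].
    by rewrite cardsU1 inE (negPf aS).
  by apply/setP => i; rewrite !inE; case: eqVneq => // ->; rewrite ae.
suff -> : [set i in a |: S | i < e] = [set i in S | i < e] by [].
by apply/setP => i; rewrite !inE; case: eqVneq => // ->; rewrite ltnNge ae /= andbF.
Qed.

Variable V : {set 'I_N} -> 'I_N -> bool.
Hypothesis mN : m < N.
Hypothesis triangle : forall S a b c, #|S|.+1 = m ->
  a \notin S -> b \notin S -> c \notin S -> a != b -> c != a -> c != b ->
  V (a |: S) b (+) V (a |: S) c (+) (V (b |: S) a (+) V (b |: S) c)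
    (+) (V (c |: S) a (+) V (c |: S) b).

(** The value that [chi (a |: Z) (+) chi (b |: Z)] must take; the factor depending on [Z] only has
    cancelled. *)
Let g Z a b := V Z a (+) V Z b (+) (spar Z a (+) spar Z b).

Let g_add Z a b c : g Z a b (+) g Z b c = g Z a c.
Proof. by rewrite /g; cases2 V; cases2 spar. Qed.

(** Each pair among [a], [b], [c] contributes exactly one true comparison through [spar_add]. Their
    number is odd, which cancels the odd parity in [triangle]. *)
Let g_triangle S a b c : #|S|.+1 = m ->
  a \notin S -> b \notin S -> c \notin S -> a != b -> c != a -> c != b ->
  g (a |: S) b c (+) g (b |: S) a c = g (c |: S) a b.
Proof.
move=> cS aS bS cS' ab ca cb; have := triangle cS aS bS cS' ab ca cb.
rewrite /g !spar_add //.
have [] : (a < b = ~~ (b < a)) /\ (a < c = ~~ (c < a)) /\ (b < c = ~~ (c < b)).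
  rewrite -!leqNgt !ltn_neqAle; split; last split.
  - by rewrite ab.
  - by rewrite eq_sym ca.
  - by rewrite eq_sym cb.
move=> -> [-> ->].
move: (b < a) (c < a) (c < b) (spar S a) (spar S b) (spar S c) => p1 p2 p3 q1 q2 q3.
move: (V (a |: S) b) (V (a |: S) c) (V (b |: S) a) (V (b |: S) c) (V (c |: S) a) (V (c |: S) b).
by move=> v1 v2 v3 v4 v5 v6; case: v1; case: v2; case: v3; case: v4; case: v5; case: v6 => //= _;
  case: p1; case: p2; case: p3; case: q1; case: q2; case: q3.
Qed.

(* The pairs (Z + a, Z + b) are the edges of a Johnson graph; [g] is closed on its
   triangles, and a potential is built by growing balls around a fixed basis [T0]. *)
Let potential T0 d (chi : {set 'I_N} -> bool) := forall Z a b, #|Z| = m ->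
  a \notin Z -> b \notin Z -> #|(a |: Z) :\: T0| <= d -> #|(b |: Z) :\: T0| <= d ->
  chi (a |: Z) (+) chi (b |: Z) = g Z a b.

Let potential_step T0 d chi : #|T0| = m.+1 -> potential T0 d chi ->
  exists chi', potential T0 d.+1 chi'.
Proof.
move=> cT0 pot.
(* Exchanging [p.1] for [p.2] brings [T] one step closer to [T0]; on the next sphere [chi'] is
   defined through an arbitrary such exchange. *)
pose cand T (p : 'I_N * 'I_N) := [&& p.1 \in T, p.1 \notin T0, p.2 \in T0 & p.2 \notin T].
pose via T (p : 'I_N * 'I_N) := chi (p.2 |: T :\ p.1) (+) g (T :\ p.1) p.1 p.2.
pose chi' T := if #|T :\: T0| <= d then chi T else
  if [pick p | cand T p] is Some p then via T p else false.
have cD a Z : a \notin Z -> #|(a |: Z) :\: T0| = (a \notin T0) + #|Z :\: T0|.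
  move=> aZ; have [aT|aT] := boolP (a \in T0).
    by rewrite setDUl (_ : [set a] :\: T0 = set0) ?set0U //; apply/eqP; rewrite setD_eq0 sub1set.
  rewrite setDUl (_ : [set a] :\: T0 = [set a]) ?cardsU1 ?inE ?(negPf aZ) ?andbF //.
  by apply/setP => e; rewrite !inE; case: eqVneq => [->|]; rewrite ?aT ?andbF.
have same_t Z t z z' : #|Z| = m -> t \notin Z -> #|(t |: Z) :\: T0| = d.+1 ->
    t \notin T0 -> z \in T0 -> z \notin Z -> z' \in T0 -> z' \notin Z ->
    chi (z |: Z) (+) g Z t z = chi (z' |: Z) (+) g Z t z'.
  move=> cZ tZ; rewrite cD // => cd tT zT zZ z'T z'Z.
  have := pot Z z z' cZ zZ z'Z; rewrite !cD // zT z'T /= add0n -ltnS.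
  move: cd; rewrite tT add1n => -[->] /(_ (leqnn _) (leqnn _)).
  by rewrite -(g_add Z t z z'); move: (g Z t z) (g Z z z') => g1 g2; cases1 chi; case: g1; case: g2.
(* The value does not depend on the exchange. Exchanges removing the same [t] agree by the potential
   on the ball; if [t1] and [t] differ, the two inner neighbours form a triangle with the basis. *)
have viaE Z t z : #|Z| = m -> t \notin Z -> z \notin Z -> t \notin T0 -> z \in T0 ->
    #|(t |: Z) :\: T0| = d.+1 -> chi' (t |: Z) = chi (z |: Z) (+) g Z t z.
  move=> cZ tZ zZ tT zT cd; rewrite /chi' cd ltnn.
  case: pickP => [[t1 z1]|/(_ (t, z))]; last first.
    rewrite /cand /= setU11 tT zT in_setU1 (negPf zZ) orbF.
    by case: eqVneq => // E; rewrite -E zT in tT.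
  case/and4P => /= t1TZ t1T z1T; rewrite in_setU1 negb_or => /andP [z1t z1Z].
  have [E|t1t] := eqVneq t1 t.
    subst t1; rewrite /via /= setU1K //.
    exact: same_t.
  have t1Z : t1 \in Z by move: t1TZ; rewrite in_setU1 (negPf t1t).
  rewrite (@same_t Z t z z1) // /via /=.
  set S := Z :\ t1.
  have eZ : Z = t1 |: S by rewrite setD1K.
  have t1S : t1 \notin S by rewrite setD11.
  have tS : t \notin S by apply: contra tZ; rewrite eZ in_setU1 => ->; rewrite orbT.
  have z1S : z1 \notin S by apply: contra z1Z; rewrite eZ in_setU1 => ->; rewrite orbT.
  have cS : #|S|.+1 = m by rewrite -cZ eZ cardsU1 t1S.
  have z1t1 : z1 != t1 by apply: contraNneq t1T => <-.
  have -> : (t |: Z) :\ t1 = t |: S.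
    by rewrite eZ setUCA setU1K // in_setU1 negb_or t1t.
  have := pot (z1 |: S) t t1; rewrite cardsU1 z1S add1n cS => /(_ erefl).
  rewrite !in_setU1 !negb_or ![_ == z1]eq_sym z1t z1t1 tS t1S => /(_ isT isT).
  have cd' : #|S :\: T0| < d.
    by move: cd; rewrite cD // tT add1n => -[<-]; rewrite eZ cD // t1T.
  rewrite !cD ?in_setU1 ?negb_or ?tS ?t1S ?[_ == z1]eq_sym ?z1t ?z1t1 // tT t1T z1T /= add0n !add1n.
  move=> /(_ cd' cd'); rewrite eZ [z1 |: (t |: S)]setUCA [z1 |: (t1 |: S)]setUCA => E.
  have := g_triangle cS tS t1S z1S; rewrite eq_sym t1t z1t z1t1 => /(_ isT isT isT).
  by rewrite -E; move: (g _ _ _) (g _ _ _) => g1 g2; cases1 chi; case: g1; case: g2.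
exists chi' => Z a b cZ aZ bZ ca cb.
have chi'_le T : #|T :\: T0| <= d -> chi' T = chi T by rewrite /chi' => ->.
have dicho e : e \notin Z -> #|(e |: Z) :\: T0| <= d.+1 ->
    #|(e |: Z) :\: T0| <= d \/ #|(e |: Z) :\: T0| = d.+1.
  by move=> _; rewrite leq_eqVlt => /predU1P [|]; [right | left].
have [ca'|ca'] := dicho a aZ ca; have [cb'|cb'] := dicho b bZ cb.
- by rewrite !chi'_le //; apply: pot.
- have [bT aT] : b \notin T0 /\ a \in T0.
    by move: ca' cb'; rewrite !cD //; case: (a \in T0); case: (b \in T0) => //=; lia.
  rewrite (chi'_le _ ca') (viaE Z b a) // /g.
  by cases1 chi; cases2 V; cases2 spar.
- have [aT bT] : a \notin T0 /\ b \in T0.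
    by move: ca' cb'; rewrite !cD //; case: (a \in T0); case: (b \in T0) => //=; lia.
  by rewrite (chi'_le _ cb') (viaE Z a b) // addbAC addbb addFb.
- have eab : (a \in T0) = (b \in T0).
    by move: ca' cb'; rewrite !cD //; case: (a \in T0); case: (b \in T0) => //=; lia.
  have [aT|aT] := boolP (a \in T0); last first.
    (* Both sets lie on the new sphere and [a], [b] outside [T0]: they have the common inner
       neighbour [z |: Z]. *)
    have [z zT zZ] : exists2 z, z \in T0 & z \notin Z.
      by apply/subsetPn; apply/negP => /subset_leq_card; rewrite cT0 cZ ltnn.
    rewrite (viaE Z a z) // (viaE Z b z) -?eab // -(g_add Z a z b).
    by rewrite /g; cases1 chi; cases2 V; cases2 spar.
  have bT : b \in T0 by rewrite -eab.
  have [->|ab] := eqVneq a b.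
    by rewrite /g !addbb.
  (* With [a] and [b] in [T0], the common inner neighbour is [a |: (b |: S)], reached by removing
     [w]. *)
  have [w wZ wT] : exists2 w, w \in Z & w \notin T0.
    apply/subsetPn; apply/negP => ZT; move: ca'; rewrite cD // aT /=.
    by move: ZT; rewrite -setD_eq0 => /eqP ->; rewrite cards0.
  set S := Z :\ w.
  have eZ : Z = w |: S by rewrite setD1K.
  have wS : w \notin S by rewrite setD11.
  have aS : a \notin S by apply: contra aZ; rewrite eZ in_setU1 => ->; rewrite orbT.
  have bS : b \notin S by apply: contra bZ; rewrite eZ in_setU1 => ->; rewrite orbT.
  have cS : #|S|.+1 = m by rewrite -cZ eZ cardsU1 wS.
  have aw : a != w by apply: contraNneq wT => <-.
  have bw : b != w by apply: contraNneq wT => <-.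
  have ba : b != a by rewrite eq_sym.
  rewrite eZ in ca' cb' *; rewrite setUCA [b |: _]setUCA in ca' cb' *.
  rewrite (viaE (a |: S) w b) ?cardsU1 ?aS ?in_setU1 ?negb_or 1?[w == _]eq_sym ?aw ?ba ?wS ?bS //.
  rewrite (viaE (b |: S) w a) ?cardsU1 ?bS ?in_setU1 ?negb_or 1?[w == _]eq_sym ?bw ?ab ?wS ?aS //.
  rewrite [b |: (a |: S)]setUCA.
  have wa : w != a by rewrite eq_sym.
  rewrite -(@g_triangle S a b w) // 1?eq_sym //.
  by rewrite /g; cases1 chi; cases2 V; cases2 spar.
Qed.

(** A ball of radius [N] contains all sets. The factor [c Z] is read off at one label outside [Z],
    and the potential makes it the same at all others. *)
Lemma chirotope_exists : exists (chi : {set 'I_N} -> bool) (c : {set 'I_N} -> bool),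
  forall Z e, #|Z| = m -> e \notin Z -> V Z e = c Z (+) chi (e |: Z) (+) spar Z e.
Proof.
have [T0 cT0] : exists T0 : {set 'I_N}, #|T0| = m.+1.
  exists [set i : 'I_N | i < m.+1].
  rewrite -sum1_card (eq_bigl (fun i : 'I_N => i < m.+1)) => [|i]; last by rewrite inE.
  by rewrite (big_ord_narrow mN) sum1_card card_ord.
have /(_ N) [chi pot] : forall d, exists chi, potential T0 d chi.
  elim=> [|d [chi pot]]; last exact: potential_step pot.
  exists (fun _ => false) => Z a b cZ aZ bZ.
  rewrite !leqn0 !cards_eq0 !setD_eq0 => sa sb.
  have ea : a |: Z = T0 by apply/eqP; rewrite eqEcard sa cardsU1 aZ cZ cT0 /=.
  have eb : b |: Z = T0 by apply/eqP; rewrite eqEcard sb cardsU1 bZ cZ cT0 /=.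
  have ab : a = b.
    by have := setU11 a Z; rewrite ea -eb in_setU1 (negPf aZ) orbF => /eqP.
  by rewrite ab /g !addbb.
pose c Z := if [pick e | e \notin Z] is Some e then V Z e (+) chi (e |: Z) (+) spar Z e else false.
exists chi, c => Z e cZ eZ; rewrite /c; case: pickP => [f fZ|/(_ e)]; last by rewrite eZ.
have cN T : #|T| <= N by rewrite -[X in _ <= X]card_ord max_card.
have := pot Z f e cZ fZ eZ (cN _) (cN _); rewrite /g.
by cases1 chi; cases2 V; cases2 spar.
Qed.

End Chirotope.

(** * Certificates *)

(* A subset of {0, ..., n - 1} is a numeral with n binary digits, least element first, below
   its leading digit 1; [bput] is the identity out of range. *)
Fixpoint bmem (p : positive) (i : nat) : bool :=
  match p, i with
  | xI _, 0 => true
  | xI q, j.+1 | xO q, j.+1 => bmem q j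
  | _, _ => false
  end.

Fixpoint bput (b : bool) (i : nat) (p : positive) : positive :=
  match p, i with
  | xI q, 0 | xO q, 0 => if b then xI q else xO q
  | xI q, j.+1 => xI (bput b j q)
  | xO q, j.+1 => xO (bput b j q)
  | xH, _ => xH
  end.

Fixpoint blen (p : positive) : nat :=
  match p with xH => 0 | xI q | xO q => (blen q).+1 end.

(** The counterpart of [spar] on numerals. *)
Fixpoint bpar (p : positive) (i : nat) : bool :=
  match i, p with
  | j.+1, xI q => ~~ bpar q j
  | j.+1, xO q => bpar q j
  | _, _ => false
  end.

Definition bempty (n : nat) : positive := iter n xO xH.
Definition bset (n : nat) (l : seq nat) : positive := foldr (bput true) (bempty n) l.

Lemma blen_put b i p : blen (bput b i p) = blen p.
Proof. by elim: p i => [p IH|p IH|] [|i] //=; rewrite ?IH //; case: (b). Qed.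

Lemma bmem_put b i p j : i < blen p -> bmem (bput b i p) j = if i == j then b else bmem p j.
Proof.
by elim: p i j => [p IH|p IH|] [|i] [|j] //=; rewrite ?ltnS ?eqSS; try (exact: IH); case: (b).
Qed.

Lemma bmem_ge p i : blen p <= i -> bmem p i = false.
Proof. by elim: p i => [p IH|p IH|] [|i] //=; rewrite ltnS => /IH. Qed.

Lemma bpar_count p i : bpar p i = odd (count (bmem p) (iota 0 i)).
Proof.
elim: p i => [p IH|p IH|] [|i] //=.
- by rewrite IH -[1]addn0 iotaDl count_map.
- by rewrite IH -[1]addn0 iotaDl count_map.
- by rewrite (eq_count (a2 := pred0)) ?count_pred0 // => -[].
Qed.

Lemma blen_empty n : blen (bempty n) = n.
Proof. by elim: n => //= n ->. Qed.

Lemma blen_set n l : blen (bset n l) = n.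
Proof. by elim: l => [|i l IH] /=; rewrite ?blen_put // blen_empty. Qed.

Lemma bmem_set n l i : bmem (bset n l) i = (i < n) && (i \in l).
Proof.
have [ni|ni] := ltnP i n; last by rewrite bmem_ge // blen_set.
elim: l => [|j l IH] /=.
  by elim: n i ni => [|n IHn] [|i] //= /IHn.
have [jn|jn] := ltnP j n.
  by rewrite bmem_put ?blen_set // inE eq_sym; case: eqVneq.
have -> : bput true j (bset n l) = bset n l.
  have : blen (bset n l) <= j by rewrite blen_set.
  elim: (bset n l) j {jn IH} => [p IHp|p IHp|] [|j] //=; rewrite ltnS => /IHp ->; by [].
by rewrite inE IH; case: eqVneq => // E; rewrite -E leqNgt ni in jn.
Qed.

Inductive trie (A : Type) := Leaf | Node of trie A & option A & trie A.
Arguments Leaf {A}.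

Fixpoint tget A (t : trie A) (p : positive) : option A :=
  match t, p with
  | Leaf, _ => None
  | Node _ x _, xH => x
  | Node l _ _, xO q => tget l q
  | Node _ _ r, xI q => tget r q
  end.

Fixpoint tset A (t : trie A) (p : positive) (a : A) : trie A :=
  match p, t with
  | xH, Leaf => Node Leaf (Some a) Leaf
  | xH, Node l _ r => Node l (Some a) r
  | xO q, Leaf => Node (tset Leaf q a) None Leaf
  | xO q, Node l x r => Node (tset l q a) x r
  | xI q, Leaf => Node Leaf None (tset Leaf q a)
  | xI q, Node l x r => Node l x (tset r q a)
  end.

Lemma tget_leaf A p : tget (@Leaf A) p = None.
Proof. by case: p. Qed.

Lemma tget_set A (t : trie A) p a q : tget (tset t p a) q = Some a /\ p = q \/ tget (tset t p a) q = tget t q.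
Proof.
elim: p t q => [p IH|p IH|] [|l x r] [q|q|] /=; rewrite ?tget_leaf; auto.
- by have [[-> ->]|->] := IH Leaf q; rewrite ?tget_leaf; auto.
- by have [[-> ->]|->] := IH r q; auto.
- by have [[-> ->]|->] := IH Leaf q; rewrite ?tget_leaf; auto.
- by have [[-> ->]|->] := IH l q; auto.
Qed.

Definition valuation := trie bool.
Definition assignment := (positive * bool)%type.

Definition xor2 (x y : option bool) : option bool :=
  if x is Some a then if y is Some b then Some (a (+) b) else None else None.

(* [(z, a, b, c, e)] is the three-term relation of z + a, b, c, e. *)
Definition gprel := (positive * nat * nat * nat * nat)%type.

Definition gp_keys (g : gprel) : positive * positive * positive * positive * positive * positive :=
  let: (z, a, b, c, e) := g in
  let f i j := bput true i (bput true j z) in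
  (f a b, f c e, f a c, f b e, f a e, f b c).

(* ab ce, - ac be and ae bc do not have the same sign. *)
Definition gp_holds (val : positive -> bool) (g : gprel) : bool :=
  let: (ab, ce, ac, be, ae, bc) := gp_keys g in
  ~~ ((val ab (+) val ce == ~~ (val ac (+) val be)) && (~~ (val ac (+) val be) == val ae (+) val bc)).

Definition gp_violated (st : valuation) (g : gprel) : bool :=
  let: (ab, ce, ac, be, ae, bc) := gp_keys g in
  match xor2 (tget st ab) (tget st ce), xor2 (tget st ac) (tget st be), xor2 (tget st ae) (tget st bc) with
  | Some u, Some v, Some w => (u == ~~ v) && (~~ v == w)
  | _, _, _ => false
  end.

(* A signed set [(z, s)] stands for the cocircuit with zero set [z] whose value at [e] is
   [s (+) bpar z e (+) val (z + e)]. *)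
Definition sset := (positive * bool)%type.
Definition lit (val : positive -> bool) (x : sset) (e : nat) : bool :=
  x.2 (+) bpar x.1 e (+) val (bput true e x.1).

(** A [Path] lists the vertices after the starting point; the first branch of a [Split] is the one
    where the sign is [true]. *)
Inductive certificate :=
  | Path of seq sset
  | Contradiction of gprel
  | Split of positive & certificate & certificate.

Fixpoint assign_all (st : valuation) (l : seq assignment) : option valuation :=
  match l with
  | [::] => Some st
  | (p, b) :: l' =>
    if tget st p is Some b' then if b == b' then assign_all st l' else None
    else assign_all (tset st p b) l'
  end.

Section Check.
Variables n m : nat.

Definition leg_cost (diff : sset -> sset -> nat -> bool) (x y : sset) : nat :=
  count (fun e => [&& ~~ bmem x.1 e, ~~ bmem y.1 e & diff x y e]) (iota 0 n).

Fixpoint path_cost diff (x : sset) (p : seq sset) : nat :=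
  if p is y :: p' then (leg_cost diff x y).+1 + path_cost diff y p' else 0.

Definition leg (x y : sset) : bool :=
  [&& count (fun e => bmem x.1 e && bmem y.1 e) (iota 0 n) == m.-1,
      count (bmem y.1) (iota 0 n) == m & blen y.1 == n].

Definition same_sset (x y : sset) : bool :=
  all (fun e => bmem x.1 e == bmem y.1 e) (iota 0 n) && (x.2 == y.2).

Definition differ val (x y : sset) e := lit val x e != lit val y e.

(** An undecided sign counts as a difference, so the cost computed at a leaf bounds the cost for
    every [val] that extends the decisions. *)
Definition may_differ (st : valuation) (x y : sset) (e : nat) : bool :=
  match tget st (bput true e x.1), tget st (bput true e y.1) with
  | Some a, Some b => x.2 (+) bpar x.1 e (+) a != y.2 (+) bpar y.1 e (+) b
  | _, _ => true
  end.

Definition good_path diff budget (x y : sset) (p : seq sset) : bool :=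
  [&& path leg x p, same_sset (last x p) y & path_cost diff x p <= budget].

Definition gp_valid (g : gprel) : bool :=
  let: (z, a, b, c, e) := g in
  [&& blen z == n, count (bmem z) (iota 0 n) == m.-1,
      all (fun i => ~~ bmem z i) [:: a; b; c; e], a < b, b < c, c < e & e < n].

Variables (budget : nat) (x y : sset).

Fixpoint check (st : valuation) (c : certificate) : bool :=
  match c with
  | Path p => good_path (may_differ st) budget x y p
  | Contradiction g => gp_valid g && gp_violated st g
  | Split k c1 c2 => check (tset st k true) c1 && check (tset st k false) c2
  end.

Variable val : positive -> bool.

Definition models (st : valuation) := forall p b, tget st p = Some b -> val p = b.
Definition all_true (l : seq assignment) := all (fun a => val a.1 == a.2) l.

Lemma models_set st p b : models st -> val p = b -> models (tset st p b).
Proof. by move=> M vp q c; have [[-> <-] [<-]|->] := tget_set st p b q; last exact: M. Qed.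

Lemma assign_all_models st l : models st -> all_true l ->
  if assign_all st l is Some st' then models st' else False.
Proof.
elim: l st => [|[p b] l IH] st //= M /andP [/eqP vp vl].
case E: (tget st p) => [b'|]; last by apply: IH => //; apply: models_set.
by rewrite -vp (M _ _ E) eqxx; apply: IH.
Qed.

Lemma good_path_sound st p : models st ->
  good_path (may_differ st) budget x y p -> good_path (differ val) budget x y p.
Proof.
move=> M /and3P [pp lp cp]; rewrite /good_path pp lp; apply: leq_trans cp.
elim: p x {pp lp} => //= z p IH x0; rewrite leq_add // ltnS.
apply: sub_count => e /and3P [-> ->]; rewrite /differ /may_differ /lit.
case E: (tget st _) => [a|//]; case F: (tget st _) => [b|//] /=.
by rewrite (M _ _ E) (M _ _ F).
Qed.

Lemma xor2_sound st a b u : models st ->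
  xor2 (tget st a) (tget st b) = Some u -> val a (+) val b = u.
Proof.
move=> M; case Ea: (tget st a) => [v|//]; case Eb: (tget st b) => [w|//] /= [<-].
by rewrite (M _ _ Ea) (M _ _ Eb).
Qed.

Lemma gp_violated_sound st g : models st -> gp_violated st g -> ~~ gp_holds val g.
Proof.
move=> M; rewrite /gp_violated /gp_holds; move: (gp_keys g) => [[[[[ab ce] ac] be] ae] bc].
case Eu: (xor2 _ _) => [u|//]; case Ev: (xor2 _ _) => [v|//]; case Ew: (xor2 _ _) => [w|//].
by rewrite (xor2_sound M Eu) (xor2_sound M Ev) (xor2_sound M Ew) negbK.
Qed.

(** The actual signs [val] single out one branch of the tree. Its leaf cannot be a [Contradiction],
    since [val] satisfies all valid relations. *)
Lemma check_sound st c : (forall g, gp_valid g -> gp_holds val g) -> models st ->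
  check st c -> exists p, good_path (differ val) budget x y p.
Proof.
move=> gp; elim: c st => [p|g|k c1 IH1 c2 IH2] st M /=.
- by move/(good_path_sound M); exists p.
- by case/andP => /gp hg /(gp_violated_sound M); rewrite hg.
- case/andP; case E: (val k); first by move=> + _; apply: IH1; apply: models_set.
  by move=> _; apply: IH2; apply: models_set.
Qed.

End Check.

(** * The configurations *)

Section Configuration.
Variables (m k d : nat) (sy : bool).
Let n := m.*2 + k.
Definition zerosX := bset n (iota 0 m).
Definition zerosY := bset n (iota m m).

(* The labels below m form X^0 \ F, the next m form Y^0 \ F, and the next d form sep X Y.
   After reorientation X is positive off X^0 and Y is positive on X^0; the labels of Y^0 are
   sorted along the coline through X on which the label 0 becomes nonzero, and the nonzero
   labels of X^0 along the coline through Y on which the label m + 1 becomes nonzero. *)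
Definition normalization : seq assignment :=
  [seq (bset n (e :: iota 0 m), bpar zerosX e) | e <- iota m (m + k)] ++
  [seq (bset n (e :: iota m m), sy (+) bpar zerosY e) | e <- iota 0 m] ++
  [seq (bset n (e :: iota m m), sy (+) (e < m.*2 + d) (+) bpar zerosY e) | e <- iota m.*2 k] ++
  flatten [seq [seq
    let z := bput true b (bput false 0 zerosX) in
    (bput true b' z, bpar z b' (+) bpar z 0 (+) bpar zerosX b)
    | b' <- iota b.+1 (m.*2 - b.+1)] | b <- iota m m] ++
  flatten [seq [seq
    let z := bput true a (bput false m.+1 zerosY) in
    (bput true a' z, bpar z a' (+) bpar z m.+1 (+) sy (+) bpar zerosY a)
    | a' <- iota a.+1 (m - a.+1)] | a <- iota 1 m.-1].

(** An inconsistent normalization is accepted, because no [val] can then satisfy it. *)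
Definition configuration_ok (c : certificate) : bool :=
  if assign_all Leaf normalization is Some st
  then check n m (m + k) (zerosX, false) (zerosY, sy) st c else true.

Lemma configuration_ok_sound val c :
  (forall g, gp_valid n m g -> gp_holds val g) -> all_true val normalization ->
  configuration_ok c ->
  exists p, good_path n m (differ val) (m + k) (zerosX, false) (zerosY, sy) p.
Proof.
move=> gp hn; rewrite /configuration_ok.
have M0 : models val Leaf by move=> [].
have := assign_all_models M0 hn.
case: (assign_all _ _) => [st|] M; last by case: M.
exact: check_sound gp M.
Qed.

End Configuration.

Definition certificate_table := seq (seq (certificate * certificate)).

Definition table_ok (m kmax : nat) (t : certificate_table) : bool :=
  all (fun k => all (fun d =>
      let c := nth (Path [::], Path [::]) (nth [::] t k) d in
      configuration_ok m k d true c.1 && configuration_ok m k d false c.2)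
    (iota 0 k.+1)) (iota 0 kmax.+1).

Lemma table_okP m kmax t k d sy : table_ok m kmax t -> k <= kmax -> d <= k ->
  exists c, configuration_ok m k d sy c.
Proof.
move=> /allP H kk dk; have /H /allP {}H : k \in iota 0 kmax.+1 by rewrite mem_iota add0n ltnS.
have /H /andP [H1 H2] : d \in iota 0 k.+1 by rewrite mem_iota add0n ltnS.
by case: sy; [exists (nth (Path [::], Path [::]) (nth [::] t k) d).1
            | exists (nth (Path [::], Path [::]) (nth [::] t k) d).2].
Qed.

(** * The search for certificates *)

(* Nothing in this section needs a correctness proof, since its results are checked. *)
Section Search.

Inductive inference := Nothing | Clash | Force of assignment.

(* [v] is the value forced on [val a (+) val b]. *)
Definition complete (st : valuation) (a b : positive) (v : bool) : inference :=
  match tget st a, tget st b with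
  | Some x, None => Force (b, x (+) v)
  | None, Some y => Force (a, y (+) v)
  | _, _ => Nothing
  end.

(** The three terms, the middle one negated, must not all agree; two equal known terms force the
    third. *)
Definition infer (st : valuation) (g : gprel) : inference :=
  let: (ab, ce, ac, be, ae, bc) := gp_keys g in
  match xor2 (tget st ab) (tget st ce), xor2 (Some true) (xor2 (tget st ac) (tget st be)),
        xor2 (tget st ae) (tget st bc) with
  | Some u, Some v, Some w => if (u == v) && (v == w) then Clash else Nothing
  | Some u, Some v, None => if u == v then complete st ae bc (~~ u) else Nothing
  | Some u, None, Some w => if u == w then complete st ac be u else Nothing
  | None, Some v, Some w => if v == w then complete st ab ce (~~ v) else Nothing
  | _, _, _ => Nothing
  end.

Definition tfind A (t : trie (seq A)) p := if tget t p is Some l then l else [::].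
Definition tadd A (g : A) (t : trie (seq A)) p := tset t p (g :: tfind t p).
Definition occurrences (gs : seq gprel) : trie (seq gprel) :=
  foldr (fun g t => let: (ab, ce, ac, be, ae, bc) := gp_keys g in
           foldl (tadd g) t [:: ab; ce; ac; be; ae; bc]) Leaf gs.

Definition step := (positive * bool * gprel)%type.
Inductive propagation := Conflict of gprel & seq step | Stable of valuation & seq step.

Fixpoint consequences (st : valuation) (gs : seq gprel) (todo : seq positive) (trail : seq step) :=
  match gs with
  | [::] => (None, st, todo, trail)
  | g :: gs' =>
    match infer st g with
    | Nothing => consequences st gs' todo trail
    | Clash => (Some g, st, todo, trail)
    | Force (p, b) => consequences (tset st p b) gs' (p :: todo) ((p, b, g) :: trail)
    end
  end.

Fixpoint propagate (fuel : nat) (occ : trie (seq gprel)) (st : valuation) (todo : seq positive)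
    (trail : seq step) : propagation :=
  match fuel, todo with
  | fuel'.+1, p :: todo' =>
    let: (clash, st', todo'', trail') := consequences st (tfind occ p) todo' trail in
    if clash is Some g then Conflict g trail' else propagate fuel' occ st' todo'' trail'
  | _, _ => Stable st trail
  end.

(* A certificate with the set of the signs it depends on; splits on other signs are dropped,
   and a forced sign is replayed as a split with one contradictory branch. *)
Definition explained := (certificate * trie bool)%type.

Fixpoint tunion (t u : trie bool) : trie bool :=
  match t, u with
  | Leaf, _ => u
  | _, Leaf => t
  | Node l x r, Node l' x' r' =>
    Node (tunion l l') (if x is Some true then x else if x' is None then x else x') (tunion r r')
  end.
Definition uses (c : explained) (p : positive) := if tget c.2 p is Some b then b else false.
Definition contradiction (g : gprel) : explained :=
  let: (ab, ce, ac, be, ae, bc) := gp_keys g in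
  (Contradiction g, foldr (fun p t => tset t p true) Leaf [:: ab; ce; ac; be; ae; bc]).
Definition split (p : positive) (c1 c2 : explained) : explained :=
  if ~~ uses c1 p then c1 else if ~~ uses c2 p then c2
  else (Split p c1.1 c2.1, tset (tunion c1.2 c2.2) p false).
Definition explain (trail : seq step) (c : explained) : explained :=
  foldl (fun c (s : step) => let: (p, b, g) := s in
    if uses c p then if b then split p c (contradiction g) else split p (contradiction g) c
    else c) c trail.
Definition path_certificate (n : nat) (x : sset) (p : seq sset) : explained :=
  (Path p, foldr (fun z t => foldr (fun e t => if bmem z.1 e then t else tset t (bput true e z.1) true)
                               t (iota 0 n)) Leaf (x :: p)).

(* A residual path records, element by element, the maximal runs of signs still to be compared,
   and the budget left. *)
Inductive item := Known of bool | Unknown of positive & bool.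
Definition rpath := (seq sset * nat * seq (seq item))%type.

Definition push (s : seq item) (ss : seq (seq item)) :=
  match s with [::] | [:: Known _] => ss | _ => s :: ss end.

(** A known change of sign is charged to the budget at once and cuts the run in two; equal known
    neighbours are merged. *)
Fixpoint simplify (st : valuation) (s : seq item) (bud : nat) (ss : seq (seq item)) :=
  match s with
  | [::] => Some ([::], bud, ss)
  | x :: s' =>
    match simplify st s' bud ss with
    | None => None
    | Some (r, bud', ss') =>
      let known b :=
        match r with
        | Known b' :: _ =>
          if b == b' then Some (r, bud', ss')
          else if bud' is bud''.+1 then Some ([:: Known b], bud'', push r ss') else None
        | _ => Some (Known b :: r, bud', ss')
        end in
      match x with
      | Known b => known b
      | Unknown k b =>
        if tget st k is Some b' then known (b' (+) b) else Some (x :: r, bud', ss')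
      end
    end
  end.

Fixpoint simplify_all (st : valuation) (ss : seq (seq item)) (bud : nat) (acc : seq (seq item)) :=
  match ss with
  | [::] => Some (bud, acc)
  | s :: ss' =>
    if simplify st s bud acc is Some (r, bud', acc') then simplify_all st ss' bud' (push r acc')
    else None
  end.

(** A lower bound for the changes along the run, however the unknown signs turn out; the upper bound
    used in [scan] is the length of the run minus 1. *)
Fixpoint known_changes (last : option bool) (s : seq item) : nat :=
  match s with
  | [::] => 0
  | Unknown _ _ :: s' => known_changes last s'
  | Known b :: s' => (if last is Some b' then nat_of_bool (b != b') else 0) + known_changes (Some b) s'
  end.

Definition unknowns (s : seq item) := count (fun x => if x is Unknown _ _ then true else false) s.

Definition bump (t : trie positive) (x : item) :=
  if x is Unknown k _ then tset t k (if tget t k is Some c then Pos.succ c else xH) else t.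

Fixpoint most_frequent (t : trie positive) (key : positive -> positive)
    (best : option (positive * positive)) :=
  match t with
  | Leaf => best
  | Node l x r =>
    let best' :=
      match x, best with
      | Some c, Some (_, c') => if Pos.compare c c' is Gt then Some (key xH, c) else best
      | Some c, None => Some (key xH, c)
      | None, _ => best
      end in
    most_frequent r (fun p => key (xI p)) (most_frequent l (fun p => key (xO p)) best')
  end.

Inductive scan_result := Found of seq sset | Live of seq rpath & trie positive.

(* Discards the paths that exceed the budget; [t] counts the unknown signs occurring in the
   paths with the least number [u] of unknown signs. *)
Fixpoint scan (st : valuation) (ps acc : seq rpath) (u : nat) (t : trie positive) :=
  match ps with
  | [::] => Live acc t
  | (p, bud, ss) :: ps' =>
    match simplify_all st ss bud [::] with
    | None => scan st ps' acc u t
    | Some (bud', ss') =>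
      if bud' < sumn (map (known_changes None) ss') then scan st ps' acc u t
      else if sumn (map (fun s => (size s).-1) ss') <= bud' then Found p
      else
        let v := sumn (map unknowns ss') in
        let acc' := (p, bud', ss') :: acc in
        if v < u then scan st ps' acc' v (foldl (foldl bump) Leaf ss')
        else if v == u then scan st ps' acc' u (foldl (foldl bump) t ss')
        else scan st ps' acc' u t
    end
  end.

(** [more] holds further families of candidate paths, tried when none is left. A failed search
    returns [Path [::]], which the checker rejects because the two ends differ. *)
Fixpoint search (fuel n : nat) (occ : trie (seq gprel)) (x : sset) (st : valuation)
    (live : seq rpath) (more : seq (seq rpath)) : explained :=
  if fuel is fuel'.+1 then
    match scan st live [::] 1000 Leaf with
    | Found p => path_certificate n x p
    | Live live' t =>
      match most_frequent t (fun p => p) None, more with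
      | None, [::] => (Path [::], Leaf)
      | None, l :: more' => search fuel' n occ x st l more'
      | Some (k, _), _ =>
        let branch b :=
          match propagate 5000 occ (tset st k b) [:: k] [::] with
          | Conflict g trail => explain trail (contradiction g)
          | Stable st' trail => explain trail (search fuel' n occ x st' live' more)
          end in
        let c1 := branch true in
        if ~~ uses c1 k then c1 else split k c1 (branch false)
      end
    end
  else (Path [::], Leaf).

(* A label [b >= m.*2], which lies in neither zero set, has to leave again once it has entered. *)
Fixpoint exchanges (m : nat) (fuel : nat) (outs ins : seq nat) (z : positive) : seq (seq positive) :=
  if fuel is fuel'.+1 then
    flatten [seq flatten [seq
      let z' := bput false a (bput true b z) in
      let outs' := filter (fun c => c != a) outs in
      [seq z' :: p | p <- exchanges m fuel' (if m.*2 <= b then b :: outs' else outs')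
                            (filter (fun c => c != b) ins) z'] | b <- ins] | a <- outs]
  else [:: [::]].

Fixpoint signings (sy : bool) (p : seq positive) : seq (seq sset) :=
  match p with
  | [::] => [:: [::]]
  | [:: z] => [:: [:: (z, sy)]]
  | z :: p' => let l := signings sy p' in
    [seq (z, true) :: q | q <- l] ++ [seq (z, false) :: q | q <- l]
  end.

Fixpoint runs (e : nat) (p : seq sset) : seq item * seq (seq item) :=
  if p is (z, s) :: p' then
    let: (cur, ss) := runs e p' in
    if bmem z e then ([::], push cur ss)
    else (Unknown (bput true e z) (s (+) bpar z e) :: cur, ss)
  else ([::], [::]).

Definition residual (n : nat) (x : sset) (budget : nat) (p : seq sset) : rpath :=
  (p, budget - size p, flatten [seq (let: (cur, ss) := runs e (x :: p) in push cur ss) | e <- iota 0 n]).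

Fixpoint choose (k : nat) (l : seq nat) : seq (seq nat) :=
  match k, l with
  | 0, _ => [:: [::]]
  | _.+1, [::] => [::]
  | k'.+1, a :: l' => [seq a :: s | s <- choose k' l'] ++ choose k l'
  end.

Definition gp_relations (n m : nat) : seq gprel :=
  flatten [seq [seq (bset n s, nth 0 q 0, nth 0 q 1, nth 0 q 2, nth 0 q 3)
                 | q <- choose 4 (filter (fun i => i \notin s) (iota 0 n))]
          | s <- choose m.-1 (iota 0 n)].

(** Paths of m exchanges come first. Unless m = 4, paths of m + 1 exchanges follow, with a detour
    through one of the last [k] labels. *)
Definition find_certificate (m k d : nat) (sy : bool) : certificate :=
  let n := m.*2 + k in
  let occ := occurrences (gp_relations n m) in
  let x := (zerosX m k, false) in
  let init := normalization m k d sy in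
  if assign_all Leaf init is Some st then
    let paths fuel ins :=
      [seq residual n x (m + k) q
        | q <- flatten [seq signings sy p | p <- exchanges m fuel (iota 0 m) ins (zerosX m k)]] in
    (match propagate 5000 occ st (map fst init) [::] with
    | Conflict g trail => explain trail (contradiction g)
    | Stable st' trail =>
      explain trail (search 300 n occ x st' (paths m (iota m m))
        (if m == 4 then [::] else [seq paths m.+1 (rcons (iota m m) e) | e <- iota m.*2 k]))
    end).1
  else Path [::].

Definition find_table (m kmax : nat) : certificate_table :=
  [seq [seq (find_certificate m k d true, find_certificate m k d false) | d <- iota 0 k.+1]
     | k <- iota 0 kmax.+1].

End Search.

(** * Certificates read as statements on chirotopes *)

Lemma all_flatten_map A B (a : pred B) (f : A -> seq B) l :
  all a (flatten [seq f x | x <- l]) = all (fun x => all a (f x)) l.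
Proof. by elim: l => //= x l IH; rewrite all_cat IH. Qed.

Section Decode.
Variable N : nat.
Implicit Types (i e : 'I_N) (S : {set 'I_N}).

Definition decode (p : positive) : {set 'I_N} := [set i : 'I_N | bmem p i].

Lemma card_count (P : pred nat) : #|[set i : 'I_N | P i]| = count P (iota 0 N).
Proof.
rewrite -sum1_card (eq_bigl (fun i : 'I_N => P i)) => [|i]; last by rewrite inE.
by rewrite -(big_mkord P (fun _ => 1)) sum1_count /index_iota subn0.
Qed.

Lemma decode_set l : decode (bset N l) = [set i : 'I_N | (i : nat) \in l].
Proof. by apply/setP => i; rewrite !inE bmem_set ltn_ord. Qed.

Lemma decode_put p i : blen p = N -> decode (bput true i p) = i |: decode p.
Proof.
move=> lp; apply/setP => j; rewrite !inE bmem_put ?lp //.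
by rewrite -val_eqE /= [val j == _]eq_sym; case: eqP.
Qed.

Lemma decode_del p i : blen p = N -> decode (bput false i p) = decode p :\ i.
Proof.
move=> lp; apply/setP => j; rewrite !inE bmem_put ?lp //.
by rewrite -val_eqE /= [val j == _]eq_sym; case: eqP.
Qed.

Lemma decode_cons i l : decode (bset N ((i : nat) :: l)) = i |: decode (bset N l).
Proof. by rewrite /= decode_put // blen_set. Qed.

Lemma bpar_spar p e : bpar p e = spar (decode p) e.
Proof.
rewrite bpar_count /spar; congr odd.
have -> : [set i in decode p | i < e] = [set i : 'I_N | bmem p i && (i < e)].
  by apply/setP => i; rewrite !inE.
rewrite (card_count (fun j => bmem p j && (j < e))).
rewrite [X in _ = count _ (iota 0 X)](_ : N = e + (N - e)); last by rewrite subnKC // ltnW.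
rewrite iotaD count_cat add0n.
have -> : count (fun j => bmem p j && (j < e)) (iota e (N - e)) = 0.
  apply/eqP; rewrite -leqn0 leqNgt -has_count; apply/hasPn => i.
  by rewrite mem_iota => /andP [ei _]; rewrite [i < e]ltnNge ei andbF.
rewrite addn0; apply: eq_in_count => i; rewrite mem_iota add0n => /= ->.
by rewrite andbT.
Qed.

End Decode.

Local Arguments bput : simpl never.

Section Interpretation.
Variables m k d : nat.
Let N := m.*2 + k.
Variables (chi : {set 'I_N} -> bool) (sy : bool).
Implicit Types (i e a b c : 'I_N) (S Z : {set 'I_N}).

Hypothesis grassmann_plucker : forall S a b c e, #|S| = m.-1 ->
  a \notin S -> b \notin S -> c \notin S -> e \notin S -> a < b -> b < c -> c < e ->
  let x i j := chi (i |: (j |: S)) in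
  ~~ ((x a b (+) x c e == ~~ (x a c (+) x b e)) && (~~ (x a c (+) x b e) == x a e (+) x b c)).

Definition labelsX : {set 'I_N} := [set i : 'I_N | i < m].
Definition labelsY : {set 'I_N} := [set i : 'I_N | m <= i < m.*2].

Hypothesis chi_X : forall e, m <= e -> chi (e |: labelsX) = spar labelsX e.
Hypothesis chi_Y : forall e, e < m -> chi (e |: labelsY) = sy (+) spar labelsY e.
Hypothesis chi_Y_rest : forall e, m.*2 <= e ->
  chi (e |: labelsY) = sy (+) (e < m.*2 + d) (+) spar labelsY e.
Hypothesis chi_order_X : forall i b c, i = 0 :> nat -> m <= b -> b < c -> c < m.*2 ->
  let Z := b |: labelsX :\ i in
  chi (c |: Z) = spar Z c (+) spar Z i (+) spar labelsX b.
Hypothesis chi_order_Y : forall i b c, i = m.+1 :> nat -> 0 < b -> b < c -> c < m ->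
  let Z := b |: labelsY :\ i in
  chi (c |: Z) = spar Z c (+) spar Z i (+) sy (+) spar labelsY b.
Hypothesis m_ge2 : 2 <= m.

Definition chi_value (p : positive) : bool := chi (decode N p).

Lemma gp_valid_holds g : gp_valid N m g -> gp_holds chi_value g.
Proof.
case: g => [[[[z a] b] c] e] /and5P [/eqP lz /eqP cz nz ab /andP [bc /andP [ce eN]]].
move: nz => /= /and5P [az bz cz' ez _].
have cN := ltn_trans ce eN; have bN := ltn_trans bc cN; have aN := ltn_trans ab bN.
have := @grassmann_plucker (decode N z) (Ordinal aN) (Ordinal bN) (Ordinal cN) (Ordinal eN).
rewrite card_count !inE => /(_ cz az bz cz' ez ab bc ce).
rewrite /gp_holds /gp_keys /chi_value.
have dec (i j : nat) (iN : i < N) (jN : j < N) :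
    decode N (bput true i (bput true j z)) = Ordinal iN |: (Ordinal jN |: decode N z).
  by rewrite (@decode_put N _ (Ordinal iN)) ?blen_put // (@decode_put N _ (Ordinal jN)).
by rewrite -!dec.
Qed.

Let blen_X : blen (zerosX m k) = N. Proof. exact: blen_set. Qed.
Let blen_Y : blen (zerosY m k) = N. Proof. exact: blen_set. Qed.
Lemma decode_X : decode N (zerosX m k) = labelsX.
Proof. by rewrite decode_set; apply/setP => i; rewrite !inE mem_iota. Qed.
Lemma decode_Y : decode N (zerosY m k) = labelsY.
Proof. by rewrite decode_set; apply/setP => i; rewrite !inE mem_iota addnn. Qed.

(** The five blocks of the list correspond, in order, to [chi_X], [chi_Y], [chi_Y_rest],
    [chi_order_X] and [chi_order_Y]. *)
Lemma normalization_holds : all_true chi_value (normalization m k d sy).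
Proof.
rewrite /all_true /normalization !all_cat; apply/and5P; split.
- rewrite all_map; apply/allP => e; rewrite mem_iota => /andP [me eN] /=.
  have {}eN : e < N by rewrite /N; lia.
  rewrite /chi_value (@decode_cons N (Ordinal eN)) -/(zerosX m k) (@bpar_spar N _ (Ordinal eN)).
  by rewrite decode_X chi_X.
- rewrite all_map; apply/allP => e; rewrite mem_iota => /andP [_ em] /=.
  have eN : e < N by rewrite /N; lia.
  rewrite /chi_value (@decode_cons N (Ordinal eN)) -/(zerosY m k) (@bpar_spar N _ (Ordinal eN)).
  by rewrite decode_Y chi_Y.
- rewrite all_map; apply/allP => e; rewrite mem_iota => /andP [me eN] /=.
  rewrite /chi_value (@decode_cons N (Ordinal eN)) -/(zerosY m k) (@bpar_spar N _ (Ordinal eN)).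
  by rewrite decode_Y chi_Y_rest.
- rewrite all_flatten_map; apply/allP => b; rewrite mem_iota => /andP [mb bm].
  rewrite all_map; apply/allP => c; rewrite mem_iota => /andP [bc cm] /=.
  have iN : 0 < N by rewrite /N; lia.
  have bN : b < N by rewrite /N; lia.
  have cN : c < N by rewrite /N; lia.
  set z := bput _ b _.
  have lz : blen z = N by rewrite /z !blen_put blen_X.
  have dz : decode N z = Ordinal bN |: labelsX :\ Ordinal iN.
    by rewrite /z (@decode_put N _ (Ordinal bN)) ?blen_put ?blen_X // (@decode_del N _ (Ordinal iN)) ?blen_X // decode_X.
  rewrite /chi_value (@decode_put N _ (Ordinal cN)) // (@bpar_spar N _ (Ordinal iN)).
  rewrite (@bpar_spar N _ (Ordinal bN)) (@bpar_spar N _ (Ordinal cN)) dz decode_X.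
  by apply/eqP; apply: (@chi_order_X (Ordinal iN) (Ordinal bN) (Ordinal cN)); rewrite //=; lia.
- rewrite all_flatten_map; apply/allP => b; rewrite mem_iota => /andP [mb bm].
  rewrite all_map; apply/allP => c; rewrite mem_iota => /andP [bc cm] /=.
  have iN : m.+1 < N by rewrite /N; lia.
  have bN : b < N by rewrite /N; lia.
  have cN : c < N by rewrite /N; lia.
  set z := bput _ b _.
  have lz : blen z = N by rewrite /z !blen_put blen_Y.
  have dz : decode N z = Ordinal bN |: labelsY :\ Ordinal iN.
    by rewrite /z (@decode_put N _ (Ordinal bN)) ?blen_put ?blen_Y // (@decode_del N _ (Ordinal iN)) ?blen_Y // decode_Y.
  rewrite /chi_value (@decode_put N _ (Ordinal cN)) // (@bpar_spar N _ (Ordinal iN)).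
  rewrite (@bpar_spar N _ (Ordinal bN)) (@bpar_spar N _ (Ordinal cN)) dz decode_Y.
  by apply/eqP; apply: (@chi_order_Y (Ordinal iN) (Ordinal bN) (Ordinal cN)); rewrite //=; lia.
Qed.

Lemma configuration_path (cert : certificate) : configuration_ok m k d sy cert ->
  exists p, good_path N m (differ chi_value) (m + k) (zerosX m k, false) (zerosY m k, sy) p.
Proof. exact: configuration_ok_sound gp_valid_holds normalization_holds. Qed.

End Interpretation.

(** * Paths of cocircuits from certificates *)

Ltac cases_sval := repeat match goal with |- context [sval ?x ?y] => case: (sval x y) end.

Section Labelled.
Variables (n r : nat) (C : {set svec n}).
Hypotheses (omC : is_OM C) (unifC : uniform C r) (chainC : has_chain C r) (r_ge2 : 2 <= r).
Variables (m k d : nat) (lab : 'I_(m.*2 + k) -> 'I_n) (F : {set 'I_n}) (X Y : svec n).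
Local Notation N := (m.*2 + k).
Implicit Types (e i a b c : 'I_N) (S Z : {set 'I_N}).

Definition zset Z := F :|: lab @: Z.
Definition leaving_X (z : 'I_N) b := b |: labelsX m k :\ z.
Definition leaving_Y (z : 'I_N) b := b |: labelsY m k :\ z.

Hypothesis m_ge2 : 2 <= m.
Hypothesis lab_inj : injective lab.
Hypothesis lab_F : forall e, lab e \notin F.
Hypothesis lab_cover : forall f, f \notin F -> exists e, f = lab e.
Hypothesis card_F : #|F| + m = r - 1.
Hypotheses (XC : X \in C) (YC : Y \in C).
Hypothesis zero_X : Xzero X = zset (labelsX m k).
Hypothesis zero_Y : Xzero Y = zset (labelsY m k).
Hypothesis agree_rest : forall e, m.*2 <= e -> (X (lab e) == Y (lab e)) = (m.*2 + d <= e).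
Hypothesis order_X : forall (z b c : 'I_N), z = 0 :> nat -> m <= b -> b < c -> c < m.*2 ->
  forall P, P \in C -> Xzero P = zset (leaving_X z b) ->
  (P (lab c) == X (lab c)) = (P (lab z) == Y (lab z)).
Hypothesis order_Y : forall (z b c : 'I_N), z = m.+1 :> nat -> 0 < b -> b < c -> c < m ->
  forall P, P \in C -> Xzero P = zset (leaving_Y z b) ->
  (P (lab c) == Y (lab c)) = (P (lab z) == X (lab z)).

Lemma in_zset Z e : (lab e \in zset Z) = (e \in Z).
Proof. by rewrite in_setU (negPf (lab_F e)) mem_imset. Qed.

Lemma zset_add a S : zset (a |: S) = lab a |: zset S.
Proof. by rewrite /zset imsetU1 setUCA. Qed.

Lemma card_zset Z : #|zset Z| = #|F| + #|Z|.
Proof.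
rewrite /zset cardsU card_imset // (_ : F :&: _ = set0) ?cards0 ?subn0 //.
apply/setP => f; rewrite in_setI in_set0; apply/negP => /andP [fF /imsetP [e _ E]].
by rewrite E (negPf (lab_F e)) in fF.
Qed.

Let labX := labelsX m k.
Let labY := labelsY m k.

Lemma card_labelsX : #|labX| = m.
Proof.
have : #|zset labX| = r - 1 by rewrite -zero_X unifC.
by rewrite card_zset -card_F => /addnI.
Qed.

Lemma card_labelsY : #|labY| = m.
Proof.
have : #|zset labY| = r - 1 by rewrite -zero_Y unifC.
by rewrite card_zset -card_F => /addnI.
Qed.

Lemma labelsX_neq_Y : labX != labY.
Proof.
have N0 : 0 < N by lia.
apply/eqP => /setP /(_ (Ordinal N0)); rewrite !inE /=; lia.
Qed.

(** [hyperplane_all] provides a cocircuit for each zero set; at the two ends [X] and [Y] themselves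
    are chosen, so that paths join these and not their negatives. *)
Lemma cocircuit_choice : exists cc : {set 'I_N} -> svec n,
  [/\ forall Z, #|Z| = m -> cc Z \in C /\ Xzero (cc Z) = zset Z, cc labX = X & cc labY = Y].
Proof.
pose cc Z := if Z == labX then X else if Z == labY then Y else
  odflt X [pick P in C | Xzero P == zset Z].
exists cc; rewrite /cc eqxx [labY == _]eq_sym (negPf labelsX_neq_Y) eqxx; split=> // Z cZ.
case: eqP => [->|_]; first by rewrite zero_X.
case: eqP => [->|_]; first by rewrite zero_Y.
have /hyperplaneP [P PC zP] : hyperplane C (zset Z).
  by apply: (hyperplane_all omC unifC) => //; rewrite card_zset cZ.
by case: pickP => [Q /andP [QC /eqP zQ] //|/(_ P)]; rewrite PC zP eqxx.
Qed.

Lemma labelled_dist_le : (forall sy, exists cert : certificate, configuration_ok m k d sy cert) -> dist_le C r X Y (m + k).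
Proof.
move=> conf_ok; have [cc [ccP ccX ccY]] := cocircuit_choice.
(* Reorientation: [V Z e] is [false] where [cc Z] agrees with [Y], for labels below [m], or with
   [X], for the others. *)
pose w e := if e < m then sval Y (lab e) else sval X (lab e).
pose V Z e := w e (+) sval (cc Z) (lab e).
have cc_nz Z e : #|Z| = m -> e \notin Z -> cc Z (lab e) != None.
  by move=> cZ eZ; rewrite -in_Xzero (ccP Z cZ).2 in_zset.
have signs S a b c : #|S|.+1 = m -> a \notin S -> b \notin S -> c \notin S ->
    a != b -> c != a -> c != b ->
    V (a |: S) b (+) V (a |: S) c (+) (V (b |: S) a (+) V (b |: S) c)
      (+) (V (c |: S) a (+) V (c |: S) b) /\
    forall e, e \notin S -> e != a -> e != b -> e != c ->
      V (a |: S) c (+) V (a |: S) e (+) (V (b |: S) c (+) V (b |: S) e) ->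
      V (a |: S) b (+) V (a |: S) e = V (c |: S) b (+) V (c |: S) e.
  move=> cS aS bS cS' ab ca cb.
  have cU x : x \notin S -> #|x |: S| = m by move=> xS; rewrite cardsU1 xS add1n.
  have [[[aC za] [bC zb]] [cC zc]] := (ccP _ (cU a aS), ccP _ (cU b bS), ccP _ (cU c cS')).
  have := @coline_signs _ _ _ omC unifC (cc (a |: S)) (cc (b |: S)) (cc (c |: S)) (zset S)
    (lab a) (lab b) (lab c) aC bC cC.
  rewrite -!zset_add !in_zset !(inj_eq lab_inj) => /(_ za zb zc aS bS cS' ab ca cb) [t1 t2].
  split; first by move: t1; rewrite /V; cases_sval; cases1 w.
  move=> e eS ea eb ec; have := t2 (lab e); rewrite in_zset !(inj_eq lab_inj).
  by move=> /(_ eS ea eb ec); rewrite /V; cases_sval; cases1 w => //= H; have := H isT.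
have mN : m < N by clear -m_ge2; lia.
have [|chi0 [c0 Vchi0]] := @chirotope_exists N m V mN.
  by move=> S a b c cS aS bS cS' ab ca cb; have [] := signs S a b c.
(* The global sign of the chirotope is chosen so that [X] becomes the signed set with sign
   [false]. *)
pose chi T := chi0 T (+) c0 labX; pose cs Z := c0 Z (+) c0 labX.
have Vchi Z e : #|Z| = m -> e \notin Z -> V Z e = cs Z (+) chi (e |: Z) (+) spar Z e.
  by move=> cZ eZ; rewrite Vchi0 // /cs /chi; case: (c0 Z); case: (c0 labX); case: (chi0 _).
have csX : cs labX = false by rewrite /cs addbb.
have chiE Z e : #|Z| = m -> e \notin Z -> chi (e |: Z) = V Z e (+) cs Z (+) spar Z e.
  by move=> cZ eZ; rewrite Vchi //; case: (cs Z); case: (chi _); case: (spar _ _).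
have inX e : (e \in labX) = (e < m) by rewrite inE.
have inY e : (e \in labY) = (m <= e < m.*2) by rewrite inE.
have VX e : m <= e -> V labX e = false.
  by move=> me; rewrite /V /w ltnNge me ccX addbb.
have VY e : e < m -> V labY e = false.
  by move=> em; rewrite /V /w em ccY addbb.
have gp S a b c e : #|S| = m.-1 -> a \notin S -> b \notin S -> c \notin S -> e \notin S ->
    a < b -> b < c -> c < e -> let x i j := chi (i |: (j |: S)) in
  ~~ ((x a b (+) x c e == ~~ (x a c (+) x b e)) && (~~ (x a c (+) x b e) == x a e (+) x b c)).
  move=> cS aS bS cS' eS ab bc ce.
  have cS1 : #|S|.+1 = m by rewrite cS prednK // ltnW.
  have neq (i j : 'I_N) : i < j -> (i != j) * (j != i).
    by move=> ij; rewrite [j == i]eq_sym -val_eqE /= neq_ltn ij.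
  have ac := ltn_trans ab bc; have ae := ltn_trans ac ce; have be := ltn_trans bc ce.
  (* The points [e], [a], [c] of the coline are compared at the fourth label [b]. The factors [cs]
     cancel, and the resulting implication rules out the forbidden sign pattern. *)
  have [_ /(_ b bS)] := @signs S e a c cS1 eS aS cS' (neq a e ae).2 (neq c e ce).1 (neq a c ac).2.
  rewrite (neq b e be) (neq a b ab) (neq b c bc) => /(_ isT isT isT).
  have VS i j : i \notin S -> j \notin S -> i != j ->
      V (i |: S) j = cs (i |: S) (+) chi (j |: (i |: S)) (+) ((i < j) (+) spar S j).
    move=> iS jS ij; rewrite Vchi ?spar_add //; first by rewrite cardsU1 iS add1n.
    by rewrite in_setU1 negb_or eq_sym ij.
  rewrite !VS ?(neq a b ab) ?(neq b c bc) ?(neq c e ce) ?(neq a c ac) ?(neq a e ae) ?(neq b e be) //.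
  rewrite ab ac !ltnNge ?(ltnW ab) ?(ltnW bc) ?(ltnW ce) ?(ltnW ac) ?(ltnW ae) ?(ltnW be) /=.
  rewrite [b |: (a |: S)]setUCA [c |: (a |: S)]setUCA /=.
  have cancel x y y' t t' : x (+) y (+) t (+) (x (+) y' (+) t') = y (+) y' (+) (t (+) t').
    by case: x; case: y; case: y'; case: t; case: t'.
  rewrite !cancel; cases1 chi; cases2 spar => //= H; by have := H isT.
(* The sign [sy] is that of [Y] relative to the normalized chirotope. *)
have [cert certP] := conf_ok (cs labY).
have [] := @configuration_path m k d chi (cs labY) gp _ _ _ _ _ m_ge2 cert certP.
- by move=> e me; rewrite chiE ?card_labelsX ?inX -?leqNgt // VX // csX.
- move=> e em; rewrite chiE ?card_labelsY ?inY ?negb_and -?ltnNge ?em // VY //.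
- move=> e me; rewrite chiE ?card_labelsY ?inY ?negb_and -?leqNgt ?me ?orbT //.
  rewrite /V /w ltnNge ccY (_ : m <= e) /=; last by apply: leq_trans me; rewrite -addnn leq_addr.
  have := agree_rest me; rewrite -sval_inj.
  + by rewrite [e < _]ltnNge => <-; case: (sval _ _); case: (sval _ _); case: (cs _); case: (spar _ _).
  + by rewrite -in_Xzero zero_X in_zset inX -leqNgt; apply: leq_trans me; rewrite -addnn leq_addr.
  + by rewrite -in_Xzero zero_Y in_zset inY negb_and -!leqNgt me orbT.
- move=> z b c z0 mb bc cm Z.
  have zX : z \in labX by rewrite inX z0; clear -z0 mb bc cm m_ge2; lia.
  have bX : b \notin labX by rewrite inX; clear -z0 mb bc cm m_ge2; lia.
  have zZ : z \notin Z by rewrite in_setU1 setD11 orbF; apply: contraNneq bX => <-.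
  have cZ : c \notin Z by rewrite in_setU1 in_setD1 inX -val_eqE /=; clear -z0 mb bc cm m_ge2; lia.
  have eZ : z |: Z = b |: labX by rewrite setUCA setD1K.
  have mZ : #|Z| = m by rewrite cardsU1 in_setD1 (negPf bX) andbF -[RHS]card_labelsX [RHS](cardsD1 z) zX.
  have := order_X z0 mb bc cm (ccP Z mZ).1 (ccP Z mZ).2.
  have nzX : X (lab c) != None by rewrite -in_Xzero zero_X in_zset inX; clear -z0 mb bc cm m_ge2; lia.
  have nzY : Y (lab z) != None by rewrite -in_Xzero zero_Y in_zset inY z0; clear -z0 mb bc cm m_ge2; lia.
  rewrite -!sval_inj ?cc_nz // => svE.
  (* In reoriented signs [order_X] says that [cc Z] has equal signs at [c] and [z]. This determines
     [chi (c |: Z)] from [chi (z |: Z)], where [z |: Z] is [b |: labX]. *)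
  have VZ : V Z c = V Z z.
    rewrite /V /w z0 ifN; last by clear -z0 mb bc cm m_ge2; lia.
    rewrite ifT; last by clear -z0 mb bc cm m_ge2; lia.
    by move: svE; do 4 case: (sval _ _).
  rewrite chiE // VZ Vchi // eZ chiE ?card_labelsX // VX // csX.
  by case: (cs Z); case: (spar Z z); case: (spar Z c); case: (spar _ b).
- move=> z b c z0 b0 bc cm Z.
  have zY : z \in labY by rewrite inY z0; clear -z0 b0 bc cm m_ge2; lia.
  have bY : b \notin labY by rewrite inY; clear -z0 b0 bc cm m_ge2; lia.
  have zZ : z \notin Z by rewrite in_setU1 setD11 orbF; apply: contraNneq bY => <-.
  have cZ : c \notin Z by rewrite in_setU1 in_setD1 inY -val_eqE /=; clear -z0 b0 bc cm m_ge2; lia.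
  have eZ : z |: Z = b |: labY by rewrite setUCA setD1K.
  have mZ : #|Z| = m by rewrite cardsU1 in_setD1 (negPf bY) andbF -[RHS]card_labelsY [RHS](cardsD1 z) zY.
  have := order_Y z0 b0 bc cm (ccP Z mZ).1 (ccP Z mZ).2.
  have nzY : Y (lab c) != None by rewrite -in_Xzero zero_Y in_zset inY; clear -z0 b0 bc cm m_ge2; lia.
  have nzX : X (lab z) != None by rewrite -in_Xzero zero_X in_zset inX z0; clear -z0 b0 bc cm m_ge2; lia.
  rewrite -!sval_inj ?cc_nz // => svE.
  have VZ : V Z c = V Z z.
    rewrite /V /w z0 ifT; last by clear -z0 b0 bc cm m_ge2; lia.
    rewrite ifN; last by clear -z0 b0 bc cm m_ge2; lia.
    by move: svE; do 4 case: (sval _ _).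
  rewrite chiE // VZ Vchi // eZ chiE ?card_labelsY // VY //; last by clear -z0 b0 bc cm m_ge2; lia.
  by case: (cs Z); case: (cs _); case: (spar Z z); case: (spar Z c); case: (spar _ b).
move=> p /and3P [pp lp cp].
(* A signed set stands for the chosen cocircuit, negated if its sign differs from the factor
   [cs]. *)
pose co (x : sset) := if x.2 (+) cs (decode N x.1) then sneg (cc (decode N x.1)) else cc (decode N x.1).
pose ok (x : sset) := (#|decode N x.1| == m) && (blen x.1 == N).
have coP x : ok x -> [/\ co x \in C, Xzero (co x) = zset (decode N x.1) &
    forall e, e \notin decode N x.1 -> w e (+) sval (co x) (lab e) = lit (chi_value chi) x e].
  case/andP => /eqP cx /eqP lx; have [cC cz] := ccP _ cx; split.
  - by rewrite /co; case: ifP => // _; apply: sneg_in.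
  - by rewrite /co; case: ifP => // _; rewrite Xzero_sneg.
  - move=> e ex; rewrite /lit /chi_value decode_put // bpar_spar chiE // /V /co.
    have := cc_nz _ e cx ex; move: (cs _) => q; case: ifP => E nz; rewrite ?sval_sneg //; move: E;
      by case: (x.2); case: q; case: (w e); case: (sval _ _); case: (spar _ _).
have legP x y : ok x -> leg N m x y -> ok y /\
    dist_le C r (co x) (co y) (leg_cost N (differ (chi_value chi)) x y).+1.
  move=> okx /and3P [/eqP cxy /eqP cy ly].
  have cyD : #|decode N y.1| = m by rewrite -[RHS]cy -card_count.
  have oky : ok y by rewrite /ok cyD eqxx; exact: ly.
  split=> //; have [xC zx litx] := coP x okx; have [yC zy lity] := coP y oky.
  have cI : #|decode N x.1 :&: decode N y.1| = m.-1.
    rewrite -[RHS]cxy -card_count; apply: eq_card => i; by rewrite !inE.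
  have cZ : r - 2 <= #|Xzero (co x) :&: Xzero (co y)|.
    (* [F] contributes r - 1 - m common zeros and the labels m - 1. *)
    have -> : r - 2 = #|zset (decode N x.1 :&: decode N y.1)|.
      by rewrite card_zset cI -subn1 addnBA ?(ltnW m_ge2) // card_F -subnDA.
    apply: subset_leq_card; rewrite zx zy /zset subsetI.
    by apply/andP; split; apply/setUS/imsetS; [exact: subsetIl | exact: subsetIr].
  have neq : co x <> sneg (co y).
    move=> E; have : zset (decode N x.1) = zset (decode N y.1) by rewrite -zx -zy E Xzero_sneg.
    move/setP => Ez; have Exy : decode N x.1 = decode N y.1.
      by apply/setP => e; have := Ez (lab e); rewrite !in_zset.
    by move: cI; rewrite Exy setIid cyD; move: m_ge2; clear; lia.
  apply: dist_le_weaken (coline_dist omC xC yC neq cZ); rewrite addn1 ltnS.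
  rewrite /leg_cost -card_count -(card_imset _ lab_inj); apply: subset_leq_card.
  (* A separating element lies outside [F], so it has a label, which is counted in the cost of the
     leg. *)
  apply/subsetP => f fs.
  have [fx fy] : f \notin Xzero (co x) /\ f \notin Xzero (co y).
    by move: fs; rewrite in_sep !in_Xzero; case: (co x f) => [[]|] //= /eqP ->.
  have [e fe] : exists e, f = lab e.
    by apply: lab_cover; apply: contra fx; rewrite zx in_setU => ->.
  move: fs fx fy; rewrite fe zx zy !in_zset => fs ex ey; apply: imset_f.
  move: (ex) (ey); rewrite !inE => -> ->; rewrite /= /differ -litx // -lity //.
  move: fs; rewrite in_sep /sval; case: (co x _) => [[]|] //= /eqP ->; by case: (w e).
have pathP x q : ok x -> path (leg N m) x q ->
    ok (last x q) /\ dist_le C r (co x) (co (last x q)) (path_cost N (differ (chi_value chi)) x q).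
  elim: q x => [|y q IH] x okx /=; first by split=> //; apply: dist_le_refl.
  case/andP => /(legP x y okx) [oky dxy] /(IH y oky) [okl dyl]; split=> //.
  exact: dist_le_trans dxy dyl.
have okX : ok (zerosX m k, false) by rewrite /ok decode_X card_labelsX blen_set !eqxx.
have [okl dXl] := pathP _ _ okX pp.
have eX : co (zerosX m k, false) = X by rewrite /co decode_X csX ccX.
have eY : co (last (zerosX m k, false) p) = Y.
  case/andP: lp => /allP sm /eqP sl.
  have dl : decode N (last (zerosX m k, false) p).1 = labY.
    rewrite /labY -(decode_Y m k); apply/setP => e; rewrite !inE; apply/eqP/sm.
    by rewrite mem_iota ltn_ord.
  by rewrite /co dl sl /= addbb ccY.
by rewrite -eX -eY; apply: dist_le_weaken dXl.
Qed.

End Labelled.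

(** * The distance bound *)

(** The second argument is 9 - 2m, the largest [k] that can occur. *)
Definition table2 := Eval vm_compute in find_table 2 5.
Definition table3 := Eval vm_compute in find_table 3 3.
Definition table4 := Eval vm_compute in find_table 4 1.

Lemma table2_ok : table_ok 2 5 table2. Proof. by vm_compute. Qed.
Lemma table3_ok : table_ok 3 3 table3. Proof. by vm_compute. Qed.
Lemma table4_ok : table_ok 4 1 table4. Proof. by vm_compute. Qed.

Lemma certificate_exists m k d sy : 2 <= m -> m.*2 + k <= 9 -> d <= k ->
  exists c, configuration_ok m k d sy c.
Proof.
move=> m2 mk dk.
have cases_m : [\/ m = 2 /\ k <= 5, m = 3 /\ k <= 3 | m = 4 /\ k <= 1].
  have m4 : m <= 4 by move: mk; rewrite -addnn; clear; lia.
  move: m2 m4 mk; clear; case: m => [|[|[|[|[|m]]]]] // _ _ mk.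
  - by constructor 1.
  - by constructor 2.
  - by constructor 3.
case: cases_m => -[-> kk].
- exact: table_okP table2_ok kk dk.
- exact: table_okP table3_ok kk dk.
- exact: table_okP table4_ok kk dk.
Qed.

Section Bound.
Variables (n r : nat) (C : {set svec n}).
Hypotheses (omC : is_OM C) (unifC : uniform C r) (chainC : has_chain C r) (r_ge2 : 2 <= r).
Hypothesis n_le9 : n <= 9.

Lemma cocircuit_dist_le X Y : X \in C -> Y \in C -> X <> sneg Y ->
  dist_le C r X Y (n - r + 1).
Proof.
move=> XC YC XnY.
have [->|/eqP XY] := eqVneq X Y; first exact: dist_le_refl.
have zXY : Xzero X <> Xzero Y by move=> /(cocircuit_unique omC XC YC) [].
set F := Xzero X :&: Xzero Y.
set A := Xzero X :\: Xzero Y; set B := Xzero Y :\: Xzero X.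
have [D eD] : exists D, D = sep X Y by exists (sep X Y).
set G := ~: (Xzero X :|: Xzero Y :|: D).
have cFA : #|F| + #|A| = r - 1 by rewrite cardsID unifC.
have cFB : #|F| + #|B| = r - 1 by rewrite /F setIC cardsID unifC.
have cAB : #|B| = #|A| by apply/eqP; rewrite -(eqn_add2l #|F|) cFA cFB.
have inA f : (f \in A) = (X f == None) && (Y f != None) by rewrite in_setD !in_Xzero andbC.
have inB f : (f \in B) = (X f != None) && (Y f == None) by rewrite in_setD !in_Xzero.
have inF f : (f \in F) = (X f == None) && (Y f == None) by rewrite in_setI !in_Xzero.
have inD f : (f \in D) = [&& X f != None, Y f != None & X f != Y f].
  by rewrite eD in_sep; case: (X f) => [[]|]; case: (Y f) => [[]|].
have inG f : (f \in G) = [&& X f != None, Y f != None & X f == Y f].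
  by rewrite in_setC 2!in_setU inD !in_Xzero; case: (X f) => [[]|]; case: (Y f) => [[]|].
have [a0 a0A] : exists a0, a0 \in A.
  apply/set0Pn/negP; rewrite setD_eq0 => sXY; apply: zXY; apply/eqP.
  by rewrite eqEcard sXY !unifC /=.
(* If [A] is a singleton, [X] and [Y] span a coline; the separation avoids the r - 1 zeros of [X]
   and the single element of [B], so it has at most n - r elements. *)
have [m1|m2] := leqP #|A| 1.
  have cA1 : #|A| = 1 by apply/eqP; rewrite eqn_leq m1; apply/card_gt0P; exists a0.
  apply: dist_le_weaken (coline_dist omC XC YC XnY _); last first.
    by rewrite -/F; move: cFA; rewrite cA1; clear; lia.
  have dD : D :&: (Xzero X :|: B) = set0.
    apply/setP => f; rewrite in_setI in_set0 inD in_setU in_Xzero inB.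
    by rewrite andbC; case: (X f); case: (Y f).
  have := max_card (D :|: (Xzero X :|: B)); rewrite card_ord cardsU.
  rewrite dD cards0 subn0 cardsU.
  have -> : Xzero X :&: B = set0.
    by apply/setP => f; rewrite in_setI in_Xzero inB in_set0; case: (X f).
  rewrite cards0 subn0 unifC // cAB cA1 -eD; move: r_ge2 #|D|; clear; lia.
set m := #|A| in m2 cAB cFA.
have zXa : Xzero X = a0 |: Xzero X :\ a0.
  by rewrite setD1K // in_Xzero; move: a0A; rewrite inA => /andP [].
have [vY YvY] : exists v, Y a0 = Some v.
  by move: a0A; rewrite inA => /andP [_]; case: (Y a0) => [v|//]; exists v.
have dBX : [disjoint B & Xzero X].
  rewrite -setI_eq0; apply/eqP/setP => f; rewrite in_setI in_set0 inB in_Xzero.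
  by rewrite andbC; case: (X f).
have [s sB ordS] := coline_order omC unifC vY chainC r_ge2 XC zXa (negbT (setD11 _ _)) dBX.
have ss : size s = m by rewrite (perm_size sB) -cardE.
(* The label 0 goes to [a0], and the label m + 1 to the second element of [s]. The remaining
   elements of [A] are then sorted along the coline through [Y] that leaves [b1]. *)
set b1 := nth a0 s 1.
have b1B : b1 \in B by rewrite -mem_enum -(perm_mem sB) mem_nth // ss.
have zYb : Xzero Y = b1 |: Xzero Y :\ b1.
  by rewrite setD1K // in_Xzero; move: b1B; rewrite inB => /andP [].
have [vX XvX] : exists v, X b1 = Some v.
  by move: b1B; rewrite inB => /andP [+ _]; case: (X b1) => [v|//]; exists v.
have dAY : [disjoint A :\ a0 & Xzero Y].
  rewrite -setI_eq0; apply/eqP/setP => f; rewrite in_setI in_set0 in_setD1 inA in_Xzero.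
  by rewrite andbC; case: (Y f) => [y|] /=; rewrite ?andbF.
have [t tA ordT] := coline_order omC unifC vX chainC r_ge2 YC zYb (negbT (setD11 _ _)) dAY.
have st : size t = m.-1 by rewrite (perm_size tA) -cardE /m (cardsD1 a0 A) a0A.
pose d := #|D|; pose k := d + #|G|.
(* The order of labels presupposed by [normalization]: zeros of [X] only, zeros of [Y] only, the
   separation, the elements of agreement. *)
pose L := (a0 :: t) ++ s ++ enum D ++ enum G.
have sL : size L = m.*2 + k.
  by rewrite !size_cat /= st prednK ?(ltnW m2) // ss -!cardE addnA addnn.
have mem_at f : (f \in a0 :: t) = (f \in A).
  by rewrite inE (perm_mem tA) mem_enum in_setD1; case: eqVneq => // ->.
have mem_s f : (f \in s) = (f \in B) by rewrite (perm_mem sB) mem_enum.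
have uL : uniq L.
  rewrite !cat_uniq /= (perm_uniq tA) (perm_uniq sB) !enum_uniq (perm_mem tA) mem_enum setD11 /=.
  rewrite !andbT; apply/and3P; split; apply/hasPn => f; rewrite ?mem_cat ?mem_at ?mem_s !mem_enum /=.
  - by rewrite inA inB inD inG; case: (X f); case: (Y f).
  - by rewrite inB inD inG; case: (X f); case: (Y f).
  - by rewrite inD inG; case: (X f == Y f); rewrite ?andbF.
have mem_L f : (f \in L) = (f \notin F).
  rewrite !mem_cat mem_at mem_s !mem_enum inA inB inD inG inF.
  by case: (X f) => [[]|]; case: (Y f) => [[]|].
have NF : m.*2 + k + #|F| = n.
  rewrite -sL -(card_uniqP uL) -[RHS]card_ord -(cardC F) addnC; congr (_ + _).
  by apply: eq_card => f; rewrite mem_L.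
pose lab (i : 'I_(m.*2 + k)) := nth a0 L i.
have lab_L i : lab i \in L by rewrite mem_nth // sL.
have lab_inj : injective lab.
  by move=> i j /eqP; rewrite nth_uniq ?sL // => /eqP /val_inj.
have lab_F i : lab i \notin F by rewrite -mem_L.
have lab_cover f : f \notin F -> exists i, f = lab i.
  rewrite -mem_L => fL; have fN : index f L < m.*2 + k by rewrite -sL index_mem.
  by exists (Ordinal fN); rewrite /lab nth_index.
have sat : size (a0 :: t) = m by rewrite /= st prednK // ltnW.
have labA (i : 'I_(m.*2 + k)) : i < m -> lab i = nth a0 (a0 :: t) i.
  by move=> im; rewrite /lab /L nth_cat sat im.
have labB (i : 'I_(m.*2 + k)) : m <= i < m.*2 -> lab i = nth a0 s (i - m).
  case/andP => mi im; rewrite /lab /L nth_cat sat ltnNge mi /= nth_cat ss.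
  by rewrite ifT // ltn_subLR // addnn.
have labDG (i : 'I_(m.*2 + k)) : m.*2 <= i -> lab i = nth a0 (enum D ++ enum G) (i - m.*2).
  move=> mi; have m_i : m <= i by apply: leq_trans mi; rewrite -addnn leq_addr.
  have m_im : m <= i - m by rewrite leq_subRL // addnn.
  by rewrite /lab /L nth_cat sat ltnNge m_i /= nth_cat ss ltnNge m_im /= -subnDA addnn.
have in_lab (i : 'I_(m.*2 + k)) : (lab i \in A) = (i < m) /\ (lab i \in B) = (m <= i < m.*2).
  have [im|mi] := ltnP i m.
    have : lab i \in A by rewrite labA // -mem_at mem_nth // sat.
    by rewrite inA inB; case: (X _); case: (Y _).
  have [im2|mi2] := ltnP i m.*2.
    have : lab i \in B by rewrite labB ?mi // -mem_s mem_nth // ss ltn_subLR // addnn.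
    by rewrite inA inB; case: (X _); case: (Y _).
  have : lab i \in enum D ++ enum G.
    rewrite labDG // mem_nth // size_cat -!cardE ltn_subLR //; exact: ltn_ord.
  rewrite mem_cat !mem_enum inD inG inA inB.
  by case: (X _); case: (Y _) => //=; rewrite ?andbF.
have inlX (i : 'I_(m.*2 + k)) : (i \in labelsX m k) = (i < m) by rewrite inE.
have inlY (i : 'I_(m.*2 + k)) : (i \in labelsY m k) = (m <= i < m.*2) by rewrite inE.
have zero_X : Xzero X = zset lab F (labelsX m k).
  apply/setP => f; rewrite in_setU.
  have [fF|/lab_cover [i ->]] := boolP (f \in F).
    by move: fF; rewrite in_setI => /andP [-> _].
  rewrite mem_imset // inlX -(in_lab i).1 inA in_Xzero.
  by have := lab_F i; rewrite inF; case: (X _); case: (Y _).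
have zero_Y : Xzero Y = zset lab F (labelsY m k).
  apply/setP => f; rewrite in_setU.
  have [fF|/lab_cover [i ->]] := boolP (f \in F).
    by move: fF; rewrite in_setI => /andP [_ ->].
  rewrite mem_imset // inlY -(in_lab i).2 inB in_Xzero.
  by have := lab_F i; rewrite inF; case: (X _); case: (Y _).
have zset_leave (Z : {set 'I_(m.*2 + k)}) z b : z \in Z ->
    zset lab F (b |: Z :\ z) = lab b |: zset lab F Z :\ lab z.
  move=> zZ; rewrite zset_add -[in RHS](setD1K zZ) zset_add setU1K //.
  by rewrite in_zset // setD11.
(* Equality holds in fact: n = 2m + k + |F| and |F| + m = r - 1. *)
have mk : m + k <= n - r + 1 by move: NF cFA r_ge2; clear -m2; move: #|F| #|A|; lia.
apply: dist_le_weaken mk _.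
apply: (@labelled_dist_le n r C omC unifC chainC r_ge2 m k d lab F X Y) => //.
- move=> e me; have := labDG e me; rewrite nth_cat -cardE -/d ltn_subLR // => labe.
  have [de|de] := leqP (m.*2 + d) e.
    have : lab e \in G.
      rewrite labe ltnNge de /= -mem_enum mem_nth // -cardE -subnDA ltn_subLR // -addnA.
      exact: ltn_ord.
    by rewrite inG => /and3P [].
  have : lab e \in D by rewrite labe de -mem_enum mem_nth // -cardE ltn_subLR.
  by rewrite inD => /and3P [_ _ /negPf].
- move=> z b c z0 mb bc cm P PC zP.
  have mc := leq_trans mb (ltnW bc); have bm := ltn_trans bc cm.
  have bc' : b - m < c - m by rewrite ltn_sub2r // (leq_ltn_trans mb).
  have bs : b - m < m by rewrite ltn_subLR ?addnn.
  have cs : c - m < m by rewrite ltn_subLR ?addnn.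
  have labz : lab z = a0 by rewrite labA z0 // ltnW.
  have /(pairwiseP a0) /(_ (b - m) (c - m)) := ordS.
  rewrite !inE ss => /(_ bs cs bc'); rewrite -!labB ?mb ?mc //.
  move=> /forallP /(_ P); rewrite PC /= labz YvY zP /leaving_X zset_leave ?inE ?z0 ?(ltnW m2) //.
  by rewrite -zero_X labz eqxx => /eqP ->.
- move=> z b c z0 b0 bc cm P PC zP.
  have c0 := ltn_trans b0 bc; have bm := ltn_trans bc cm.
  have zm : m <= z < m.*2 by rewrite z0 leqnSn -addnn -addn1 ltn_add2l.
  have labz : lab z = b1 by rewrite labB // z0 subSnn.
  have labt (i : 'I_(m.*2 + k)) : 0 < i -> i < m -> lab i = nth a0 t i.-1.
    by move=> i0 im; rewrite labA //; case: (i : nat) i0.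
  have bc' : b.-1 < c.-1 by rewrite -ltnS !prednK.
  have bt : b.-1 < m.-1 by rewrite -ltnS !prednK // ltnW.
  have ct : c.-1 < m.-1 by rewrite -ltnS !prednK // ltnW.
  have /(pairwiseP a0) /(_ b.-1 c.-1) := ordT.
  rewrite !inE st => /(_ bt ct bc').
  rewrite -!labt // => /forallP /(_ P); rewrite PC /= labz XvX zP /leaving_Y zset_leave ?inE //.
  by rewrite -zero_Y labz eqxx => /eqP ->.
- move=> sy; apply: certificate_exists => //; last exact: leq_addr.
  by apply: leq_trans n_le9; rewrite -NF leq_addr.
Qed.

End Bound.

Theorem theorem4p1 (n r : nat) (C : {set svec n}) :
  2 <= r -> r <= n -> n <= 9 ->
  is_OM C -> OM_rank C r -> uniform C r ->
  diam_is C r (n - r + 2) /\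
  (forall X Y, X \in C -> Y \in C -> X <> sneg Y ->
     exists2 d, is_dist C r X Y d & d <= n - r + 1).
Proof.
move=> r2 rn n9 omC [chC _] unifC.
have bound X Y : X \in C -> Y \in C -> X <> sneg Y -> dist_le C r X Y (n - r + 1).
  exact: cocircuit_dist_le.
split; last by move=> X Y XC YC XnY; apply/is_dist_exists/bound.
split=> [X Y XC YC|].
  apply: is_dist_exists; have [->|/eqP XnY] := eqVneq X (sneg Y).
    by rewrite -{2}[Y]snegK; apply: antipodal_dist_le => //; apply: sneg_in.
  by apply: dist_le_weaken (bound X Y XC YC XnY); rewrite leq_add2l.
(* Any set of r - 1 elements is the zero set of some cocircuit, and this cocircuit and its negative
   attain the diameter. *)
have [A cA] : exists A : {set 'I_n}, #|A| = r - 1.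
  have r1n : r - 1 <= n by apply: leq_trans rn; apply: leq_subr.
  exists [set i : 'I_n | i < r - 1].
  by rewrite -sum1_card (eq_bigl (fun i : 'I_n => i < r - 1)) => [|i];
    rewrite ?inE // (big_ord_narrow r1n) sum1_card card_ord.
have [X XC _] := hyperplaneP _ _ (hyperplane_all omC unifC r2 chC cA).
exists X, (sneg X); split=> //; first exact: sneg_in.
split=> [|k kd [p [pp lp sp]]]; first exact: antipodal_dist_le.
have := leq_trans (antipodal_dist_ge omC unifC r2 XC pp lp) sp.
by rewrite (card_supp unifC XC); move: kd r2 rn; clear; lia.
Qed.
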